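(* Let $\Sigma$ be a simply-connected Riemann surface, and let $f:\Sigma\to\mathbb{R}^3$ be a conformal immersion of non-zero constant mean curvature $H$ (not a round sphere) without umbilic points, with normalized isothermic coordinate $z=x+iy$ on $\Sigma$, metric $e^{2u}(dx^2+dy^2)$, unit normal $N$ and Hopf differential function $Q$ (so $H=2Q$). Let $f^d=f+H^{-1}N$ be the dual surface. Let $0<r<1$, let $F=F(z,\bar z,\lambda)$ be an extended $r$-unitary frame of $f$ (as defined in the context), and choose a real value of $\lambda$ with $r<\lambda<1$. Put $$D=\begin{pmatrix}1/\sqrt{\lambda}&0\\0&\sqrt{\lambda}\end{pmatrix}.$$ Then the two surfaces $F\bar F^t$ and $FD\,\overline{FD}^t$ from $\Sigma$ to the hyperbolic space $H^3$ (Hermitian matrix model), each evaluated at that value of $\lambda$, are both isothermic constant mean curvature immersions in $H^3$, and the following hold: 1. $F\bar F^t$ is the Lawson correspondent to a homothety of $f^d$, i.e. to $s f^d$ for some $s\in\mathbb{R}\setminus\{0\}$. 2. $FD\,\overline{FD}^t$ is the Lawson correspondent to a homothety of $f$, i.e. to $s f$ for some $s\in\mathbb{R}\setminus\{0\}$. 3. $FD\,\overline{FD}^t$ is an equidistant (parallel) surface to $F\bar F^t$, and its mean curvature is opposite in sign to that of $F\bar F^t$ (i.e. the mean curvature of $FD\,\overline{FD}^t$ equals minus that of $F\bar F^t$, with the unit normals specified in the context).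
   Context: **Euclidean data.** For a conformal immersion $f:\Sigma\to\mathbb{R}^3$ with unit normal $N$ and complex coordinate $z=x+iy$, write $I=e^{2u}(dx^2+dy^2)$ for the induced metric, $Q=\langle f_{zz},N\rangle$ for the Hopf differential function, and $H=2e^{-2u}\langle f_{z\bar z},N\rangle$ for the mean curvature, where $\langle\cdot,\cdot\rangle$ is the complex bilinear extension of the Euclidean inner product. The coordinate $z$ is isothermic if it is a conformal curvature line coordinate, equivalently if $Q$ is real-valued. **Dual surface and normalized coordinate.** For $f$ of constant mean curvature $H\ne 0$, the dual (Christoffel transform) is taken to be $f^d=f+H^{-1}N$ with unit normal $N^d=-N$. An isothermic coordinate $z$ on $\Sigma$ is called normalized if it is scaled so that the metrics of $f$ and $f^d$ are inverse to each other and $H=2Q$; thus $Q$ is a real non-zero constant. Then $f$ has data $I=e^{2u}(dx^2+dy^2)$, $Q$, $H$, and $f^d$ has data $I_d=e^{-2u}(dx^2+dy^2)$, $Q_d=Q$, $H_d=H$. **Extended $r$-unitary frame.** For $0<r<1$, let $A_r=\{\lambda\in\mathbb{C}: r<|\lambda|<1/r\}$. An extended $r$-unitary frame of $f$ is a map $F:\Sigma\times A_r\to \mathrm{SL}_2\mathbb{C}$, smooth in $z$ and holomorphic in $\lambda\in A_r$, with $F\in \mathrm{SU}_2$ whenever $|\lambda|=1$, satisfying $F_z=FU$, $F_{\bar z}=FV$ with $$U=\frac12\begin{pmatrix}-u_z&2e^{-u}\lambda^{-1}Q\\-He^u&u_z\end{pmatrix},\qquad V=\frac12\begin{pmatrix}u_{\bar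 z}&He^u\\-2e^{-u}\lambda Q&-u_{\bar z}\end{pmatrix}.$$ (The compatibility condition is the Gauss equation $4u_{z\bar z}-4Q^2e^{-2u}+H^2e^{2u}=0$.) $\bar F^t$ denotes the conjugate transpose of $F$ at the same value of $\lambda$. **Hyperbolic space.** Minkowski space $\mathbb{R}^{3,1}$ is identified with the Hermitian $2\times 2$ matrices $X=\begin{pmatrix} x_0+x_3 & x_1-ix_2 \\ x_1+ix_2 & x_0-x_3 \end{pmatrix}$, with metric $$\langle X,Y\rangle=-\tfrac12\,\mathrm{tr}\left(X\begin{pmatrix}0&-i\\i&0\end{pmatrix}Y^t\begin{pmatrix}0&-i\\i&0\end{pmatrix}\right),$$ so $\langle X,X\rangle=-\det X$. Then $H^3=\{X: x_0>0,\ \det X=1\}=\{F\bar F^t: F\in \mathrm{SL}_2\mathbb{C}\}$. For a conformal immersion $g:\Sigma\to H^3$ with metric $e^{2w}(dx^2+dy^2)$ and unit normal $n$ (tangent to $H^3$, orthogonal to the surface), the Hopf differential function is $\langle g_{zz},n\rangle$ and the mean curvature is $2e^{-2w}\langle g_{z\bar z},n\rangle$, with the complex bilinear extension of $\langle\cdot,\cdot\rangle$. The immersion is isothermic with respect to $z$ if it is conformal and its Hopf differential function is real-valued. **Unit normals.** For $F\bar F^t$ the unit normal is $F\begin{pmatrix}1&0\\0&-1\end{pmatrix}\bar F^t$, and for $FD\,\overline{FD}^t$ it is $FD\begin{pmatrix}1&0\\0&-1\end{pmatrix}\overline{FD}^t$. The mean curvatures in item 3 are taken with respect to these. **Homotheties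 and Lawson correspondence.** For $s\in\mathbb{R}\setminus\{0\}$, the Lawson correspondent in $H^3$ of $sf$ (respectively $sf^d$) is the conformal immersion $\Sigma\to H^3$, determined up to isometry of $H^3$, which for a suitable choice of unit normal (either of the two choices is allowed) has metric, Hopf differential function and mean curvature $$s^2e^{2u}(dx^2+dy^2),\quad sQ,\quad \sqrt{(s^{-1}H)^2+1}$$ (respectively $s^2e^{-2u}(dx^2+dy^2)$, $sQ$, $\sqrt{(s^{-1}H)^2+1}$). **Equidistant surface.** An immersion $\hat g:\Sigma\to H^3$ is an equidistant (parallel) surface to an immersion $g:\Sigma\to H^3$ with unit normal $n$ if $\hat g=(\cosh t)\,g+(\sinh t)\,n$ for some real constant $t$. *)

(* Defs.v *)
From HB Require Import structures.
From mathcomp Require Import all_boot all_order all_algebra.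
From mathcomp Require Import sesquilinear spectral.
From mathcomp Require Import all_classical all_reals all_analysis.
From mathcomp Require Import complex.

Set Implicit Arguments.
Unset Strict Implicit.
Unset Printing Implicit Defensive.
Import Order.TTheory GRing.Theory Num.Theory.
Import numFieldNormedType.Exports.

Local Open Scope classical_set_scope.
Local Open Scope complex_scope.
Local Open Scope ring_scope.
Local Open Scope sesquilinear_scope.

Section Topology.
Variables (R : realType) (S : topologicalType).

Definition unit_interval : set R := [set t | 0 <= t <= 1].

(* Paths and homotopies are parametrized by R and R * R, of which only the
   restrictions to the unit interval and the unit square matter. *)
Definition simply_connected : Prop :=
  (forall p q : S, exists c : R -> S, [/\ continuous c, c 0 = p & c 1 = q]) /\
  (forall c : R -> S, continuous c -> c 0 = c 1 ->
     exists h : R * R -> S,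
       [/\ continuous h,
           forall t, unit_interval t -> h (0, t) = c t,
           forall t, unit_interval t -> h (1, t) = c 0 &
           forall s, unit_interval s -> h (s, 0) = c 0 /\ h (s, 1) = c 0]).

(* A coordinate z = x + i y, given as the map p |-> (x p, y p).  It is a local
   homeomorphism to the plane, and the complex structure of S is the one for
   which z is locally biholomorphic: a Riemann surface with a holomorphic
   function without critical points is the same thing as a Hausdorff space with
   a local homeomorphism to the plane.  Global injectivity is not required. *)
Definition complex_coordinate (z : S -> R * R) : Prop :=
  [/\ continuous z,
      forall U : set S, open U -> open (z @` U) &
      forall p : S, exists U : set S, [/\ open U, U p & set_inj U z]].

End Topology.

Section Calculus.
Variables (R : realType) (S : topologicalType) (z : S -> R * R).

(* Some open neighbourhood of p on which z is injective (when z is a complex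
   coordinate); the germ at z p of the local inverse of z does not depend on
   the neighbourhood chosen. *)
Definition coord_nbhd (p : S) : set S :=
  xget setT [set U : set S | [/\ open U, U p & set_inj U z]].

Definition coord_inv (p : S) : R * R -> S :=
  'pinv_(fun=> p) (coord_nbhd p) z.

Definition ex : R * R := (1, 0).
Definition ey : R * R := (0, 1).

Definition pdR (v : R * R) (h : S -> R) (p : S) : R :=
  'D_v (h \o coord_inv p) (z p).

Definition pderivable (v : R * R) (h : S -> R) : Prop :=
  forall p, derivable (h \o coord_inv p) (z p) v.

Fixpoint Ck (k : nat) (h : S -> R) : Prop :=
  continuous h /\
  if k is k'.+1 then
    [/\ pderivable ex h, pderivable ey h, Ck k' (pdR ex h) & Ck k' (pdR ey h)]
  else True.

Definition smooth (h : S -> R) : Prop := forall k, Ck k h.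

Definition pd (v : R * R) (h : S -> R[i]) (p : S) : R[i] :=
  pdR v (fun q => complex.Re (h q)) p +i* pdR v (fun q => complex.Im (h q)) p.

Definition dz (h : S -> R[i]) (p : S) : R[i] :=
  2^-1 * (pd ex h p - 'i * pd ey h p).

Definition dzbar (h : S -> R[i]) (p : S) : R[i] :=
  2^-1 * (pd ex h p + 'i * pd ey h p).

Definition entrywise (d : (S -> R[i]) -> S -> R[i]) m n
    (g : S -> 'M[R[i]]_(m, n)) (p : S) : 'M[R[i]]_(m, n) :=
  \matrix_(i, j) d (fun q => g q i j) p.

Definition smooth_mx m n (g : S -> 'M[R[i]]_(m, n)) : Prop :=
  forall i j, smooth (fun q => complex.Re (g q i j)) /\
              smooth (fun q => complex.Im (g q i j)).

End Calculus.

(* Surfaces in a real quadratic space whose complexification is a space of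
   complex matrices; B is the complex bilinear extension of the form.  A surface
   takes values in the real points, but is regarded as a map into the
   complexification. *)
Section Surfaces.
Variables (R : realType) (S : topologicalType) (z : S -> R * R).
Variables (m n : nat).
Variable B : 'M[R[i]]_(m, n) -> 'M[R[i]]_(m, n) -> R[i].
Implicit Types g nu : S -> 'M[R[i]]_(m, n).

Definition mx_x g := entrywise (pd z (ex R)) g.
Definition mx_y g := entrywise (pd z (ey R)) g.
Definition mx_z g := entrywise (dz z) g.
Definition mx_zbar g := entrywise (dzbar z) g.

Definition immersion g : Prop :=
  smooth_mx z g /\
  forall p (a b : R), a%:C *: mx_x g p + b%:C *: mx_y g p = 0 -> a = 0 /\ b = 0.

(* The induced metric is E (dx^2 + dy^2). *)
Definition has_metric g (E : S -> R) : Prop :=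
  forall p, [/\ B (mx_x g p) (mx_x g p) = (E p)%:C,
                B (mx_y g p) (mx_y g p) = (E p)%:C &
                B (mx_x g p) (mx_y g p) = 0].

Definition conformal_immersion g : Prop :=
  immersion g /\ exists E : S -> R, (forall p, 0 < E p) /\ has_metric g E.

(* e^(2w) when the metric is e^(2w) (dx^2 + dy^2) *)
Definition conformal_factor g (p : S) : R[i] := B (mx_x g p) (mx_x g p).

Definition hopf g nu (p : S) : R[i] := B (mx_z (mx_z g) p) (nu p).

Definition mean_curvature g nu (p : S) : R[i] :=
  2 * (conformal_factor g p)^-1 * B (mx_zbar (mx_z g) p) (nu p).

Definition isothermic g nu : Prop :=
  conformal_immersion g /\ forall p, hopf g nu p \is Num.real.

Definition normal_field g nu : Prop :=
  smooth_mx z nu /\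
  forall p, [/\ B (nu p) (nu p) = 1, B (nu p) (mx_x g p) = 0 &
                B (nu p) (mx_y g p) = 0].

End Surfaces.

Section Euclidean.
Variables (R : realType) (S : topologicalType) (z : S -> R * R).

Definition dot (X Y : 'rV[R[i]]_3) : R[i] := \sum_(i < 3) X 0 i * Y 0 i.

Definition cplx (f : S -> 'rV[R]_3) (p : S) : 'rV[R[i]]_3 :=
  map_mx (real_complex R) (f p).

Definition cmc_surface (f N : S -> 'rV[R]_3) (H : R) : Prop :=
  [/\ conformal_immersion z dot (cplx f), normal_field z dot (cplx f) (cplx N) &
      forall p, mean_curvature z dot (cplx f) (cplx N) p = H%:C].

Definition in_round_sphere (f : S -> 'rV[R]_3) : Prop :=
  exists (c : 'rV[R]_3) (rho : R), 0 < rho /\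
    forall p, \sum_(i < 3) (f p 0 i - c 0 i) ^+ 2 = rho ^+ 2.

Definition dual_surface (f N : S -> 'rV[R]_3) (H : R) (p : S) : 'rV[R]_3 :=
  f p + H^-1 *: N p.

Definition normalized_isothermic (f N : S -> 'rV[R]_3) (u : S -> R)
    (Q H : R) : Prop :=
  [/\ isothermic z dot (cplx f) (cplx N),
      has_metric z dot (cplx f) (fun p => expR (2 * u p)),
      has_metric z dot (cplx (dual_surface f N H)) (fun p => expR (- 2 * u p)),
      forall p, hopf z dot (cplx f) (cplx N) p = Q%:C &
      H = 2 * Q].

End Euclidean.

Section Frames.
Variables (R : realType) (S : topologicalType) (z : S -> R * R).

Definition mx22 (a b c d : R[i]) : 'M[R[i]]_2 :=
  \matrix_(i, j) if i == 0 then (if j == 0 then a else b)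
                 else (if j == 0 then c else d).

Definition annulus (r : R) : set R[i] :=
  [set l | r%:C < `|l| /\ `|l| < (r^-1)%:C].

Definition frame_U (u : S -> R) (Q H : R) (l : R[i]) (p : S) : 'M[R[i]]_2 :=
  let uz := dz z (fun q => (u q)%:C) p in
  2^-1 *: mx22 (- uz) (2 * (expR (- u p))%:C * l^-1 * Q%:C)
               (- (H%:C * (expR (u p))%:C)) uz.

Definition frame_V (u : S -> R) (Q H : R) (l : R[i]) (p : S) : 'M[R[i]]_2 :=
  let uzbar := dzbar z (fun q => (u q)%:C) p in
  2^-1 *: mx22 uzbar (H%:C * (expR (u p))%:C)
               (- (2 * (expR (- u p))%:C * l * Q%:C)) (- uzbar).

(* F p l is only constrained for l in the annulus.  Holomorphy is complex
   differentiability of each entry: R[i]^o is the normed space R[i] over the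
   field R[i]. *)
Definition extended_frame (r : R) (u : S -> R) (Q H : R)
    (F : S -> R[i] -> 'M[R[i]]_2) : Prop :=
  [/\ forall l, annulus r l ->
        (forall p, \det (F p l) = 1) /\ smooth_mx z (fun p => F p l),
      forall p i j l, annulus r l ->
        derivable (fun w : R[i]^o => F p w i j : R[i]^o) l 1,
      forall p l, `|l| = 1 -> F p l \is unitarymx &
      forall l p, annulus r l ->
        mx_z z (fun q => F q l) p = F p l *m frame_U u Q H l p /\
        mx_zbar z (fun q => F q l) p = F p l *m frame_V u Q H l p].

End Frames.

Section Hyperbolic.
Variables (R : realType) (S : topologicalType) (z : S -> R * R).
Implicit Types g nu : S -> 'M[R[i]]_2.

Definition mink_mx (x0 x1 x2 x3 : R) : 'M[R[i]]_2 :=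
  mx22 (x0 + x3)%:C (x1 -i* x2) (x1 +i* x2) (x0 - x3)%:C.

Definition mink (X Y : 'M[R[i]]_2) : R[i] :=
  let J := mx22 0 (- 'i) 'i 0 in
  - 2^-1 * \tr (X *m J *m Y^T *m J).

Definition H3 : set 'M[R[i]]_2 :=
  [set X | exists x0 x1 x2 x3 : R,
     [/\ X = mink_mx x0 x1 x2 x3, 0 < x0 & \det X = 1]].

(* Unit normal inside H3: a real vector of Minkowski space, tangent to H3 (that
   is, orthogonal to the position vector). *)
Definition normal_field_H3 g nu : Prop :=
  [/\ forall p, exists x0 x1 x2 x3 : R, nu p = mink_mx x0 x1 x2 x3,
      forall p, mink (nu p) (g p) = 0 & normal_field z mink g nu].

Definition isothermic_cmc_H3 g nu : Prop :=
  [/\ forall p, H3 (g p), isothermic z mink g nu, normal_field_H3 g nu &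
      exists h : R, forall p, mean_curvature z mink g nu p = h%:C].

(* g is a Lawson correspondent of the homothetic surface s f, where f has unit
   normal N: with respect to N, the data of s f are those of f with the metric
   multiplied by s^2, the Hopf function by s and the mean curvature by s^-1.
   The choice of the unit normal nu of g is free. *)
Definition lawson_correspondent (s : R) (f N : S -> 'rV[R]_3) g : Prop :=
  [/\ forall p, H3 (g p), conformal_immersion z mink g &
      exists (H : R) (nu : S -> 'M[R[i]]_2),
        [/\ cmc_surface z f N H, normal_field_H3 g nu &
            forall p,
              [/\ conformal_factor z mink g p =
                    s%:C ^+ 2 * conformal_factor z (@dot R) (cplx f) p,
                  hopf z mink g nu p =
                    s%:C * hopf z (@dot R) (cplx f) (cplx N) p &
                  mean_curvature z mink g nu p =
                    (Num.sqrt ((s^-1 * H) ^+ 2 + 1))%:C]]].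

(* The coefficients are cosh t and sinh t. *)
Definition equidistant g nu (g' : S -> 'M[R[i]]_2) : Prop :=
  exists t : R, forall p,
    g' p = ((expR t + expR (- t)) / 2)%:C *: g p +
           ((expR t - expR (- t)) / 2)%:C *: nu p.

Definition hyp_surface (G : S -> 'M[R[i]]_2) (p : S) : 'M[R[i]]_2 :=
  G p *m (G p)^t*.

Definition hyp_normal (G : S -> 'M[R[i]]_2) (p : S) : 'M[R[i]]_2 :=
  G p *m mx22 1 0 0 (- 1) *m (G p)^t*.

End Hyperbolic.

(* Main.v *)
(* At a real value of lambda the matrices U and V are real up to the diagonal
   entries -al, al of U and al^*, -al^* of V.  For a constant real
   diagonal matrix A, the derivative of F A F^* with respect to z is
   F (U A + A V^* ) F^*, and the diagonal entries cancel: in the basis carried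
   by F, the derivatives of the surface F F^* and of its normal have only
   off-diagonal, real entries.
   Since det F = 1, conjugation by F preserves the Minkowski form, so the first
   and second fundamental forms can be read off these entries.  Right
   multiplication by D only rescales the off-diagonal entries of U and V, so
   both surfaces are instances of the same computation.
   Second derivatives are avoided throughout: as <g_z, n> = 0, one has
   <g_zz, n> = - <g_z, n_z> and <g_zzbar, n> = - <g_z, n_zbar>.  For the dual
   surface f + N / H, its prescribed metric determines <N_z, N_z> and
   <N_z, N_zbar>, hence its Hopf function and mean curvature. *)

Require Import Defs.
From HB Require Import structures.
From mathcomp Require Import all_boot all_order all_algebra.
From mathcomp Require Import sesquilinear spectral.
From mathcomp Require Import all_classical all_reals all_analysis.
From mathcomp Require Import complex.
From mathcomp Require Import ring lra.

Set Implicit Arguments.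
Unset Strict Implicit.
Unset Printing Implicit Defensive.
Import Order.TTheory GRing.Theory Num.Theory.
Import numFieldNormedType.Exports.

Local Open Scope classical_set_scope.
Local Open Scope complex_scope.
Local Open Scope ring_scope.
Local Open Scope sesquilinear_scope.

(** * Smooth functions *)

Section SmoothFunctions.
Variables (R : realType) (S : topologicalType) (z : S -> R * R).
Hypothesis hz : complex_coordinate z.
Implicit Types (h k : S -> R) (v : R * R) (n : nat).

Definition coord_dir v := v = ex R \/ v = ey R.

(** [coord_nbhd] is an [xget] with the whole space as default; local injectivity of a complex
    coordinate makes the choice a genuine neighbourhood of [p]. Hence [h \o coord_inv z p] has the
    value [h p] at [z p], as the product rule for [pdR] requires. *)
Lemma coord_invK p : coord_inv z p (z p) = p.
Proof.
case: hz => _ _ /(_ p) locinj.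
have [U0 U0p] := locinj.
have /= [_ Up injU] : [set U : set S | [/\ open U, U p & set_inj U z]]
    (coord_nbhd z p) by apply: xgetPex; exists U0.
by rewrite /coord_inv pinvKV // inE.
Qed.

Lemma pdR_cst v (c : R) p : pdR z v (fun=> c) p = 0.
Proof. exact: derive_cst. Qed.

Lemma pderivable_cst v (c : R) : pderivable z v (fun=> c).
Proof. by move=> p; exact: derivable_cst. Qed.

Lemma pderivableD v h k : pderivable z v h -> pderivable z v k ->
  pderivable z v (fun q => h q + k q).
Proof. by move=> hh hk p; exact: derivableD (hh p) (hk p). Qed.

Lemma pderivableM v h k : pderivable z v h -> pderivable z v k ->
  pderivable z v (fun q => h q * k q).
Proof. by move=> hh hk p; exact: derivableM (hh p) (hk p). Qed.

Lemma pdRD v h k p : pderivable z v h -> pderivable z v k ->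
  pdR z v (fun q => h q + k q) p = pdR z v h p + pdR z v k p.
Proof. by move=> hh hk; exact: deriveD (hh p) (hk p). Qed.

Lemma pdRM v h k p : pderivable z v h -> pderivable z v k ->
  pdR z v (fun q => h q * k q) p = pdR z v h p * k p + h p * pdR z v k p.
Proof.
move=> hh hk; rewrite /pdR; etransitivity; first exact: deriveM (hh p) (hk p).
by rewrite /= coord_invK addrC /GRing.scale /= (mulrC (k p)).
Qed.

(** Quantifying over the two coordinate directions lets inductions on the order of differentiability
    treat both at once. *)
Lemma CkS n h : Ck z n.+1 h <->
  continuous h /\ forall v, coord_dir v -> pderivable z v h /\ Ck z n (pdR z v h).
Proof.
split=> [[ch [hx hy kx ky]]|[ch hv]]; first split.
- exact: ch.
- by move=> v [] ->; split; [exact: hx | exact: kx | exact: hy | exact: ky].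
have [[hx kx] [hy ky]] := (hv _ (or_introl erefl), hv _ (or_intror erefl)).
by split; [exact: ch | split; [exact: hx | exact: hy | exact: kx | exact: ky]].
Qed.

Lemma Ck_le n h : Ck z n.+1 h -> Ck z n h.
Proof.
elim: n h => [|n IHn] h /CkS[ch hv]; first by split; [exact: ch|].
apply/CkS; split; first exact: ch.
by move=> v /hv [hdv /IHn hk]; split; [exact: hdv | exact: hk].
Qed.

Lemma Ck_cst n (c : R) : Ck z n (fun=> c).
Proof.
elim: n c => [|n IHn] c; first by split; [exact: cst_continuous|].
apply/CkS; split=> [|v _]; first exact: cst_continuous.
split; first exact: pderivable_cst.
have -> : pdR z v (fun=> c) = fun=> 0 by apply/funext => p; exact: pdR_cst.
exact: IHn.
Qed.

Lemma CkD n h k : Ck z n h -> Ck z n k -> Ck z n (fun q => h q + k q).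
Proof.
have cD h' k' : continuous h' -> continuous k' ->
    continuous (fun q : S => h' q + k' q : R).
  by move=> ch ck p; exact: cvgD (ch p) (ck p).
elim: n h k => [|n IHn] h k hh hk.
  by split; [apply: cD; [case: hh|case: hk]|].
move/CkS: hh => [ch hv]; move/CkS: hk => [ck kv].
apply/CkS; split=> [|v dv]; first exact: cD.
have [[hd hn] [kd kn]] := (hv _ dv, kv _ dv).
split; first exact: pderivableD.
have -> : pdR z v (fun q => h q + k q) = fun q => pdR z v h q + pdR z v k q.
  by apply/funext => p; exact: pdRD.
exact: IHn.
Qed.

Lemma CkM n h k : Ck z n h -> Ck z n k -> Ck z n (fun q => h q * k q).
Proof.
have cM h' k' : continuous h' -> continuous k' ->
    continuous (fun q : S => h' q * k' q : R).
  by move=> ch ck p; exact: cvgM (ch p) (ck p).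
elim: n h k => [|n IHn] h k hh hk.
  by split; [apply: cM; [case: hh|case: hk]|].
(* The derivative of a product contains the undifferentiated factors, so these are needed at order
   [n] as well. *)
have [hl kl] := (Ck_le hh, Ck_le hk).
move/CkS: hh => [ch hv]; move/CkS: hk => [ck kv].
apply/CkS; split=> [|v dv]; first exact: cM.
have [[hd hn] [kd kn]] := (hv _ dv, kv _ dv).
split; first exact: pderivableM.
have -> : pdR z v (fun q => h q * k q) =
    fun q => pdR z v h q * k q + h q * pdR z v k q.
  by apply/funext => p; exact: pdRM.
by apply: CkD; apply: IHn.
Qed.

Lemma smooth_cst (c : R) : smooth z (fun=> c).
Proof. by move=> n; exact: Ck_cst. Qed.

Lemma smoothD h k : smooth z h -> smooth z k -> smooth z (fun q => h q + k q).
Proof. by move=> hh hk n; exact: CkD. Qed.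

Lemma smoothM h k : smooth z h -> smooth z k -> smooth z (fun q => h q * k q).
Proof. by move=> hh hk n; exact: CkM. Qed.

Lemma smoothN h : smooth z h -> smooth z (fun q => - h q).
Proof.
move=> hh; rewrite (_ : (fun q => - h q) = fun q => -1 * h q).
  exact: smoothM (smooth_cst _) hh.
by apply/funext => q; rewrite mulN1r.
Qed.

Lemma smooth_pderivable v h : coord_dir v -> smooth z h -> pderivable z v h.
Proof. by move=> dv /(_ 1%N) /CkS[_ /(_ _ dv) []]. Qed.

Lemma smooth_pdR v h : coord_dir v -> smooth z h -> smooth z (pdR z v h).
Proof. by move=> dv hh n; have /CkS[_ /(_ _ dv) []] := hh n.+1. Qed.

End SmoothFunctions.

(** * Derivations *)

Section Derivations.
Variables (R : realType) (S : topologicalType) (z : S -> R * R).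
Hypothesis hz : complex_coordinate z.
Implicit Types (h k : S -> R[i]).

(** Stated through real and imaginary parts so that [smooth_mx] is, by conversion, [csmooth] for
    every entry. *)
Definition csmooth h : Prop :=
  smooth z (fun q => complex.Re (h q)) /\ smooth z (fun q => complex.Im (h q)).

Lemma csmooth_cst (c : R[i]) : csmooth (fun=> c).
Proof. by split; exact: smooth_cst. Qed.

Lemma ReD (x y : R[i]) :
  complex.Re (x + y) = complex.Re x + complex.Re y.
Proof. by case: x y => ? ? []. Qed.

Lemma ImD (x y : R[i]) :
  complex.Im (x + y) = complex.Im x + complex.Im y.
Proof. by case: x y => ? ? []. Qed.

Lemma ReM (x y : R[i]) : complex.Re (x * y) =
  complex.Re x * complex.Re y + - (complex.Im x * complex.Im y).
Proof. by case: x y => ? ? []. Qed.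

Lemma ImM (x y : R[i]) : complex.Im (x * y) =
  complex.Re x * complex.Im y + complex.Im x * complex.Re y.
Proof. by case: x y => ? ? []. Qed.

Lemma csmoothD h k : csmooth h -> csmooth k -> csmooth (fun q => h q + k q).
Proof.
move=> [hr hi] [kr ki]; split.
- under eq_fun do rewrite ReD.
  exact: smoothD.
- under eq_fun do rewrite ImD.
  exact: smoothD.
Qed.

Lemma csmoothM h k : csmooth h -> csmooth k -> csmooth (fun q => h q * k q).
Proof.
move=> [hr hi] [kr ki]; split.
- under eq_fun do rewrite ReM.
  by apply: smoothD; [|apply: (smoothN hz)]; exact: smoothM.
- under eq_fun do rewrite ImM.
  by apply: smoothD; exact: smoothM.
Qed.

Lemma csmooth_conj h : csmooth h -> csmooth (fun q => (h q)^*).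
Proof.
move=> [hr hi]; split.
- have -> // : (fun q => complex.Re (h q)^*) = fun q => complex.Re (h q).
  by apply/funext => q; case: (h q).
- have -> : (fun q => complex.Im (h q)^*) = fun q => - complex.Im (h q).
    by apply/funext => q; case: (h q).
  exact: (smoothN hz).
Qed.

Lemma csmooth_pd v h : coord_dir v -> csmooth h -> csmooth (pd z v h).
Proof. by move=> dv [hr hi]; split; exact: smooth_pdR. Qed.

Lemma csmooth_dz h : csmooth h -> csmooth (dz z h).
Proof.
move=> sh; apply: csmoothM; first exact: csmooth_cst.
apply: csmoothD; first by apply: csmooth_pd => //; left.
under eq_fun do rewrite -mulNr.
by apply: csmoothM; [exact: csmooth_cst|apply: csmooth_pd => //; right].
Qed.

(** Common interface of [pd], [dz] and [dzbar]: the rules for matrices and bilinear forms are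
    derived from it once for all three. *)
Definition derivation (d : (S -> R[i]) -> S -> R[i]) : Prop :=
  [/\ forall c p, d (fun=> c) p = 0,
      forall h k p, csmooth h -> csmooth k ->
        d (fun q => h q + k q) p = d h p + d k p &
      forall h k p, csmooth h -> csmooth k ->
        d (fun q => h q * k q) p = d h p * k p + h p * d k p].

Lemma derivation_pd v : coord_dir v -> derivation (pd z v).
Proof.
move=> dv; split=> [c p|h k p [hr hi] [kr ki]|h k p [hr hi] [kr ki]].
- by rewrite /pd !pdR_cst.
- apply/eqP; rewrite eq_complex /pd /=; apply/andP; split; apply/eqP.
  + under eq_fun do rewrite ReD.
    by apply: pdRD; exact: smooth_pderivable.
  + under eq_fun do rewrite ImD.
    by apply: pdRD; exact: smooth_pderivable.
- have pM (a b : S -> R) : smooth z a -> smooth z b ->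
      pdR z v (fun q => a q * b q) p = pdR z v a p * b p + a p * pdR z v b p.
    by move=> sa sb; apply: pdRM => //; exact: smooth_pderivable.
  have pD (a b : S -> R) : smooth z a -> smooth z b ->
      pdR z v (fun q => a q + b q) p = pdR z v a p + pdR z v b p.
    by move=> sa sb; apply: pdRD => //; exact: smooth_pderivable.
  have pN (a : S -> R) : smooth z a ->
      pdR z v (fun q => - a q) p = - pdR z v a p.
    move=> sa; under eq_fun do rewrite -mulN1r.
    rewrite pM //; last exact: smooth_cst.
    by rewrite pdR_cst mul0r add0r mulN1r.
  apply/eqP; rewrite eq_complex; apply/andP; split; apply/eqP.
  + rewrite [LHS]/=; under eq_fun do rewrite ReM.
    have sM := smoothM hz; have sN := smoothN hz.
    rewrite pD ?pN ?pM //; try by [exact: sM | apply: sN; exact: sM].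
    by case: (h p) (k p) => ? ? [? ?] /=; ring.
  + rewrite [LHS]/=; under eq_fun do rewrite ImM.
    rewrite pD ?pM //; try by exact: (smoothM hz).
    by case: (h p) (k p) => ? ? [? ?] /=; ring.
Qed.

Lemma derivation_dz : derivation (dz z).
Proof.
have [x0 xD xM] := derivation_pd (or_introl erefl).
have [y0 yD yM] := derivation_pd (or_intror erefl).
split=> [c p|h k p sh sk|h k p sh sk]; rewrite /dz.
- by rewrite x0 y0; ring.
- rewrite (xD _ _ _ sh sk) (yD _ _ _ sh sk).
  by move: (pd _ _ h p) (pd _ _ k p) (pd _ _ h p) (pd _ _ k p) => *; ring.
- rewrite (xM _ _ _ sh sk) (yM _ _ _ sh sk).
  move: (h p) (k p) (pd _ _ h p) (pd _ _ k p) (pd _ _ h p) (pd _ _ k p) => *.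
  by ring.
Qed.

Lemma derivation_dzbar : derivation (dzbar z).
Proof.
have [x0 xD xM] := derivation_pd (or_introl erefl).
have [y0 yD yM] := derivation_pd (or_intror erefl).
split=> [c p|h k p sh sk|h k p sh sk]; rewrite /dzbar.
- by rewrite x0 y0; ring.
- rewrite (xD _ _ _ sh sk) (yD _ _ _ sh sk).
  by move: (pd _ _ h p) (pd _ _ k p) (pd _ _ h p) (pd _ _ k p) => *; ring.
- rewrite (xM _ _ _ sh sk) (yM _ _ _ sh sk).
  move: (h p) (k p) (pd _ _ h p) (pd _ _ k p) (pd _ _ h p) (pd _ _ k p) => *.
  by ring.
Qed.

Lemma pd_conj v h p : coord_dir v -> csmooth h ->
  pd z v (fun q => (h q)^*) p = (pd z v h p)^*.
Proof.
move=> dv [hr hi]; rewrite /pd; apply/eqP; rewrite eq_complex.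
apply/andP; split; apply/eqP; rewrite [LHS]/= [RHS]/=.
- by congr (pdR z v _ p); apply/funext => q; case: (h q).
- have -> : (fun q => complex.Im (h q)^*) = fun q => -1 * complex.Im (h q).
    by apply/funext => q; case: (h q) => /= *; rewrite mulN1r.
  have pi := smooth_pderivable dv hi.
  rewrite (pdRM hz p (@pderivable_cst R S z v (-1)) pi).
  by rewrite pdR_cst mul0r add0r mulN1r.
Qed.

(** The directional derivatives commute with conjugation while the coefficient ['i] changes sign, so
    conjugation exchanges [dz] and [dzbar]. *)
Lemma dz_conj h p : csmooth h -> dz z (fun q => (h q)^*) p = (dzbar z h p)^*.
Proof.
move=> sh; rewrite /dz /dzbar !pd_conj; [|by right|done|by left|done].
by rewrite rmorphM rmorphD rmorphM /= conjCi fmorphV rmorph_nat mulNr.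
Qed.

Lemma dzbar_conj h p : csmooth h -> dzbar z (fun q => (h q)^*) p = (dz z h p)^*.
Proof.
move=> sh; rewrite /dz /dzbar !pd_conj; [|by right|done|by left|done].
by rewrite rmorphM rmorphB rmorphM /= conjCi fmorphV rmorph_nat mulNr opprK.
Qed.

Lemma csmooth_sum (I : Type) (s : seq I) (h : I -> S -> R[i]) :
  (forall i, csmooth (h i)) -> csmooth (fun q => \sum_(i <- s) h i q).
Proof.
move=> sh; elim: s => [|i s IHs].
  by under eq_fun do rewrite big_nil; exact: csmooth_cst.
by under eq_fun do rewrite big_cons; exact: csmoothD.
Qed.

Lemma derivation_sum d (I : Type) (s : seq I) (h : I -> S -> R[i]) p :
  derivation d -> (forall i, csmooth (h i)) ->
  d (fun q => \sum_(i <- s) h i q) p = \sum_(i <- s) d (h i) p.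
Proof.
move=> [d0 dD _] sh; elim: s => [|i s IHs].
  by under eq_fun do rewrite big_nil; rewrite big_nil d0.
under eq_fun do rewrite big_cons.
by rewrite big_cons dD ?IHs //; exact: csmooth_sum.
Qed.

End Derivations.

(** * Calculus of matrix-valued functions *)

Section MatrixDerivations.
Variables (R : realType) (S : topologicalType) (z : S -> R * R).
Hypothesis hz : complex_coordinate z.
Implicit Types d : (S -> R[i]) -> S -> R[i].

Lemma smooth_mxP m n (X : S -> 'M[R[i]]_(m, n)) :
  (forall i j, csmooth z (fun q => X q i j)) -> smooth_mx z X.
Proof. by []. Qed.

Lemma smooth_mxE m n (X : S -> 'M[R[i]]_(m, n)) i j :
  smooth_mx z X -> csmooth z (fun q => X q i j).
Proof. exact. Qed.

Lemma smooth_mx_cst m n (A : 'M[R[i]]_(m, n)) : smooth_mx z (fun=> A).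
Proof. by apply: smooth_mxP => i j; exact: csmooth_cst. Qed.

Lemma smooth_mxM m n l (X : S -> 'M[R[i]]_(m, n)) (Y : S -> 'M[R[i]]_(n, l)) :
  smooth_mx z X -> smooth_mx z Y -> smooth_mx z (fun q => X q *m Y q).
Proof.
move=> sX sY; apply: smooth_mxP => i j; under eq_fun do rewrite mxE.
by apply: csmooth_sum => k; apply: (csmoothM hz); exact: smooth_mxE.
Qed.

Lemma smooth_mxD m n (X Y : S -> 'M[R[i]]_(m, n)) :
  smooth_mx z X -> smooth_mx z Y -> smooth_mx z (fun q => X q + Y q).
Proof.
move=> sX sY; apply: smooth_mxP => i j; under eq_fun do rewrite mxE.
by apply: csmoothD; exact: smooth_mxE.
Qed.

Lemma smooth_mxZ m n c (X : S -> 'M[R[i]]_(m, n)) :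
  smooth_mx z X -> smooth_mx z (fun q => c *: X q).
Proof.
move=> sX; apply: smooth_mxP => i j; under eq_fun do rewrite mxE.
by apply: (csmoothM hz); [exact: csmooth_cst|exact: smooth_mxE].
Qed.

Lemma smooth_mx_adj m n (X : S -> 'M[R[i]]_(m, n)) :
  smooth_mx z X -> smooth_mx z (fun q => (X q)^t*).
Proof.
move=> sX; apply: smooth_mxP => i j; under eq_fun do rewrite !mxE.
by apply: (csmooth_conj hz); exact: smooth_mxE.
Qed.

Lemma smooth_mx_z m n (X : S -> 'M[R[i]]_(m, n)) :
  smooth_mx z X -> smooth_mx z (mx_z z X).
Proof.
move=> sX; apply: smooth_mxP => i j; under eq_fun do rewrite mxE.
by apply: (csmooth_dz hz); exact: smooth_mxE.
Qed.

Lemma derivation_mxM d m n l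
    (X : S -> 'M[R[i]]_(m, n)) (Y : S -> 'M[R[i]]_(n, l)) p :
  derivation z d -> smooth_mx z X -> smooth_mx z Y ->
  entrywise d (fun q => X q *m Y q) p =
  entrywise d X p *m Y p + X p *m entrywise d Y p.
Proof.
move=> dd sX sY; have [_ _ dM] := dd; apply/matrixP => i j; rewrite !mxE.
under eq_fun do rewrite mxE.
rewrite (derivation_sum _ _ dd); last first.
  by move=> k; apply: (csmoothM hz); exact: smooth_mxE.
rewrite -big_split /=; apply: eq_bigr => k _; rewrite !mxE.
by apply: dM; exact: smooth_mxE.
Qed.

Lemma derivation_mx_cst d m n (A : 'M[R[i]]_(m, n)) p :
  derivation z d -> entrywise d (fun=> A) p = 0.
Proof. by case=> d0 _ _; apply/matrixP => i j; rewrite !mxE. Qed.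

Lemma derivation_mxD d m n (X Y : S -> 'M[R[i]]_(m, n)) p :
  derivation z d -> smooth_mx z X -> smooth_mx z Y ->
  entrywise d (fun q => X q + Y q) p = entrywise d X p + entrywise d Y p.
Proof.
move=> [_ dD _] sX sY; apply/matrixP => i j; rewrite !mxE.
by under eq_fun do rewrite mxE; apply: dD; exact: smooth_mxE.
Qed.

Lemma derivation_mxZ d m n c (X : S -> 'M[R[i]]_(m, n)) p :
  derivation z d -> smooth_mx z X ->
  entrywise d (fun q => c *: X q) p = c *: entrywise d X p.
Proof.
move=> [d0 _ dM] sX; apply/matrixP => i j; rewrite !mxE.
under eq_fun do rewrite mxE; rewrite dM ?d0 ?mul0r ?add0r //.
exact: csmooth_cst.
Qed.

Lemma mx_z_adj m n (X : S -> 'M[R[i]]_(m, n)) p :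
  smooth_mx z X -> mx_z z (fun q => (X q)^t*) p = (mx_zbar z X p)^t*.
Proof.
move=> sX; apply/matrixP => i j; rewrite !mxE.
by under eq_fun do rewrite !mxE; rewrite (dz_conj hz) //; exact: smooth_mxE.
Qed.

Lemma mx_zbar_adj m n (X : S -> 'M[R[i]]_(m, n)) p :
  smooth_mx z X -> mx_zbar z (fun q => (X q)^t*) p = (mx_z z X p)^t*.
Proof.
move=> sX; apply/matrixP => i j; rewrite !mxE.
by under eq_fun do rewrite !mxE; rewrite (dzbar_conj hz) //; exact: smooth_mxE.
Qed.

Lemma mx_zE m n (X : S -> 'M[R[i]]_(m, n)) p :
  mx_z z X p = 2^-1 *: (mx_x z X p - 'i *: mx_y z X p).
Proof. by apply/matrixP => i j; rewrite !mxE. Qed.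

Lemma mx_zbarE m n (X : S -> 'M[R[i]]_(m, n)) p :
  mx_zbar z X p = 2^-1 *: (mx_x z X p + 'i *: mx_y z X p).
Proof. by apply/matrixP => i j; rewrite !mxE. Qed.

Lemma mx_xE m n (X : S -> 'M[R[i]]_(m, n)) p :
  mx_x z X p = mx_z z X p + mx_zbar z X p.
Proof.
apply/matrixP => i j; rewrite !mxE /dz /dzbar.
by move: (pd _ _ _ p) (pd _ _ _ p) => *; field.
Qed.

Lemma mx_yE m n (X : S -> 'M[R[i]]_(m, n)) p :
  mx_y z X p = 'i *: (mx_z z X p - mx_zbar z X p).
Proof.
apply/matrixP => i j; rewrite !mxE /dz /dzbar.
move: (pd _ _ _ p) (pd _ _ _ p) => a b; move: (sqrCi R[i]) => i2.
(* [field] treats ['i] as an atom, so its square is isolated here and evaluated afterwards. *)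
have -> : 'i * (2^-1 * (a - 'i * b) - 2^-1 * (a + 'i * b)) = - 'i ^+ 2 * b.
  by field.
by rewrite i2 opprK mul1r.
Qed.

End MatrixDerivations.

(** * Surfaces in a quadratic space *)

Section BilinearForms.
Variables (R : realType) (m n : nat).
Variable B : 'M[R[i]]_(m, n) -> 'M[R[i]]_(m, n) -> R[i].

Definition symmetric_bilinear : Prop :=
  (forall X Y, B X Y = B Y X) /\
  (forall c X Y Z, B (c *: X + Y) Z = c * B X Z + B Y Z).

Hypothesis hB : symmetric_bilinear.

Lemma formC X Y : B X Y = B Y X. Proof. exact: hB.1. Qed.

Lemma formDl X Y Z : B (X + Y) Z = B X Z + B Y Z.
Proof. by rewrite -{1}[X]scale1r hB.2 mul1r. Qed.

Lemma form0l Z : B 0 Z = 0.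
Proof. by apply: (addrI (B 0 Z)); rewrite -formDl !addr0. Qed.

Lemma formZl c X Z : B (c *: X) Z = c * B X Z.
Proof. by rewrite -[c *: X]addr0 hB.2 form0l addr0. Qed.

Lemma formNl X Z : B (- X) Z = - B X Z.
Proof. by rewrite -scaleN1r formZl mulN1r. Qed.

Lemma formDr X Y Z : B X (Y + Z) = B X Y + B X Z.
Proof. by rewrite !(formC X) formDl. Qed.

Lemma formZr c X Y : B X (c *: Y) = c * B X Y.
Proof. by rewrite !(formC X) formZl. Qed.

Lemma formNr X Y : B X (- Y) = - B X Y.
Proof. by rewrite !(formC X) formNl. Qed.

Lemma form_suml (I : Type) (s : seq I) (F : I -> 'M[R[i]]_(m, n)) Z :
  B (\sum_(i <- s) F i) Z = \sum_(i <- s) B (F i) Z.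
Proof.
elim: s => [|i s IHs]; first by rewrite !big_nil form0l.
by rewrite !big_cons formDl IHs.
Qed.

Lemma form_expandl X Y : B X Y =
  \sum_(t : 'I_m * 'I_n) X t.1 t.2 * B (delta_mx t.1 t.2) Y.
Proof.
rewrite {1}[X]matrix_sum_delta pair_bigA /= form_suml.
by apply: eq_bigr => t _; rewrite formZl.
Qed.

(** In the basis of matrix units the form is a finite sum of products of entries with constant
    coefficients; this reduces its product rule to the scalar one. *)
Lemma form_expand X Y : B X Y =
  \sum_(t : 'I_m * 'I_n) \sum_(w : 'I_m * 'I_n)
    X t.1 t.2 * Y w.1 w.2 * B (delta_mx t.1 t.2) (delta_mx w.1 w.2).
Proof.
rewrite form_expandl; apply: eq_bigr => t _.
rewrite formC form_expandl mulr_sumr; apply: eq_bigr => w _.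
by rewrite formC mulrA.
Qed.

Definition formE := (formZl, formZr, formDl, formDr, formNl, formNr).

End BilinearForms.

(** * First and second fundamental forms in complex notation *)

Section SurfaceForms.
Variables (R : realType) (S : topologicalType) (z : S -> R * R).
Hypothesis hz : complex_coordinate z.
Variables (m n : nat).
Variable B : 'M[R[i]]_(m, n) -> 'M[R[i]]_(m, n) -> R[i].
Hypothesis hB : symmetric_bilinear B.
Implicit Types X Y g nu : S -> 'M[R[i]]_(m, n).

Lemma derivation_form d X Y p : derivation z d ->
  smooth_mx z X -> smooth_mx z Y ->
  d (fun q => B (X q) (Y q)) p =
  B (entrywise d X p) (Y p) + B (X p) (entrywise d Y p).
Proof.
move=> dd sX sY; have [d0 _ dM] := dd.
pose c t w := B (delta_mx t.1 t.2) (delta_mx w.1 w.2).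
have sc t w : csmooth z (fun=> c t w) by exact: csmooth_cst.
have sXY t w : csmooth z (fun q => X q t.1 t.2 * Y q w.1 w.2).
  by apply: (csmoothM hz); exact: smooth_mxE.
have sXYc t w : csmooth z (fun q => X q t.1 t.2 * Y q w.1 w.2 * c t w).
  exact: csmoothM.
under eq_fun do rewrite (form_expand hB).
rewrite (derivation_sum _ _ dd); last by move=> t; exact: csmooth_sum.
rewrite [in RHS](form_expand hB) [X in _ + X](form_expand hB) -big_split /=.
apply: eq_bigr => t _; rewrite (derivation_sum _ _ dd) // -big_split /=.
apply: eq_bigr => w _; rewrite (dM _ _ _ (sXY t w) (sc t w)) d0 mulr0 addr0.
rewrite (dM _ _ _ (smooth_mxE _ _ sX) (smooth_mxE _ _ sY)) !mxE.
by rewrite mulrDl.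
Qed.

(** Conformality in complex notation, with [a] and [b] the x- and y-derivatives: the z-derivative is
    isotropic, and its product with the zbar-derivative is half the conformal factor. *)
Lemma form_z_zbar (a b : 'M[R[i]]_(m, n)) (E : R[i]) :
  B a a = E -> B b b = E -> B a b = 0 ->
  [/\ B (2^-1 *: (a - 'i *: b)) (2^-1 *: (a - 'i *: b)) = 0,
      B (2^-1 *: (a + 'i *: b)) (2^-1 *: (a + 'i *: b)) = 0 &
      B (2^-1 *: (a - 'i *: b)) (2^-1 *: (a + 'i *: b)) = E / 2].
Proof.
move=> aa bb ab; have ba : B b a = 0 by rewrite (formC hB).
rewrite !(formE hB) aa bb ab ba; move: 'i (sqrCi R[i]) => i i2.
by split; field: i2.
Qed.

Lemma metric_z g E p : has_metric z B g E ->
  [/\ B (mx_z z g p) (mx_z z g p) = 0,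
      B (mx_zbar z g p) (mx_zbar z g p) = 0 &
      B (mx_z z g p) (mx_zbar z g p) = (E p)%:C / 2].
Proof.
by move=> /(_ p) [xx yy xy]; rewrite mx_zE mx_zbarE; exact: form_z_zbar.
Qed.

Lemma complex_eq0 (x : R) : (x%:C == 0) = (x == 0).
Proof. exact: (inj_eq (@complexI _) x 0). Qed.

(** Pairing a linear relation between the coordinate derivatives with each of them leaves one
    coefficient times [E p], so both coefficients vanish. *)
Lemma metric_immersion g E : smooth_mx z g -> (forall p, 0 < E p) ->
  has_metric z B g E -> conformal_immersion z B g.
Proof.
move=> sg E_gt0 gE; split; last by exists E.
split=> [|p a b ab0]; first exact: sg.
have [xx yy xy] := gE p.
have En0 : (E p)%:C != 0 by rewrite complex_eq0 gt_eqF.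
have Bx : B (a%:C *: mx_x z g p + b%:C *: mx_y z g p) (mx_x z g p) = 0.
  by rewrite ab0 (form0l hB).
have By : B (a%:C *: mx_x z g p + b%:C *: mx_y z g p) (mx_y z g p) = 0.
  by rewrite ab0 (form0l hB).
move: (mx_x z g p) (mx_y z g p) xx yy xy Bx By {ab0} => vx vy xx yy xy.
rewrite !(formE hB) xx yy (formC hB vy) xy.
rewrite !mulr0 addr0 add0r => /eqP; rewrite mulf_eq0 (negPf En0) orbF.
rewrite complex_eq0 => /eqP-> /eqP; rewrite mulf_eq0 (negPf En0) orbF.
by rewrite complex_eq0 => /eqP->.
Qed.

Lemma opp_normal_form (c a b : 'M[R[i]]_(m, n)) (h : R[i]) :
  B c a = 0 -> B c b = 0 -> B (-1 *: c) (a + h *: b) = 0.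
Proof. by move=> ca cb; rewrite !(formE hB) ca cb !mulr0 addr0. Qed.

Lemma opp_unit_form (c : 'M[R[i]]_(m, n)) :
  B c c = 1 -> B (-1 *: c) (-1 *: c) = 1.
Proof. by move=> cc; rewrite !(formE hB) cc mulr1 mulN1r opprK. Qed.

(** Here [a], [b], [c], [d] stand for f_z, f_zbar, N_z, N_zbar, the scalars [h], [q] for H, Q, and
    [e], [e'] for the conformal factors of f and its dual. The two hypotheses on the dual metric
    determine the unknown products [B c c] and [B c d]; the conclusions follow by linearity. *)
Lemma dual_form (a b c d : 'M[R[i]]_(m, n)) (h q e e' : R[i]) : h != 0 ->
  B a a = 0 -> B a b = e / 2 -> B a c = - q ->
  B a d = - (h * e / 2) -> B b c = - (h * e / 2) ->
  B (a + h^-1 *: c) (a + h^-1 *: c) = 0 ->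
  B (a + h^-1 *: c) (b + h^-1 *: d) = e' / 2 ->
  B (a + h^-1 *: c) (- c) = - q /\ B (a + h^-1 *: c) (- d) = - (h * e' / 2).
Proof.
move=> h0 aa ab ac ad bc; rewrite !(formE hB) (formC hB c a) (formC hB c b).
rewrite aa ab ac ad bc; move: (B c c) (B c d) => x y Ex Ey; split.
(* The bracket is the left side of the isotropy relation [Ex], so rewriting with [Ex] leaves x =
   2hq. *)
- have -> : x = h ^+ 2 * (0 + h^-1 * - q + (h^-1 * - q + h^-1 * (h^-1 * x))) +
      2 * h * q by field.
  by rewrite Ex; field.
- by rewrite -[h * e' / 2]mulrA -Ey; field.
Qed.

Section Normal.
Variables (g nu : S -> 'M[R[i]]_(m, n)) (p : S).
Hypotheses (sg : smooth_mx z g) (hnu : normal_field z B g nu).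

Lemma normal_z q : B (mx_z z g q) (nu q) = 0.
Proof.
have [_ /(_ q) [_ nx ny]] := hnu.
rewrite (formC hB) mx_zE.
move: (nu q) (mx_x z g q) (mx_y z g q) nx ny => n0 vx vy nx ny.
by rewrite !(formE hB) nx ny !mulr0 subr0 mulr0.
Qed.

(** Twice this product is the derivative of the constant function [B nu nu = 1]. *)
Lemma derivation_normal d : derivation z d -> B (nu p) (entrywise d nu p) = 0.
Proof.
move=> dd; have [snu nn] := hnu; have [d0 _ _] := dd.
have := derivation_form p dd snu snu.
have -> : (fun q => B (nu q) (nu q)) = fun=> 1.
  by apply/funext => q; have [] := nn q.
rewrite d0 (formC hB) => /esym/eqP.
by rewrite -mulr2n mulrn_eq0 => /eqP.
Qed.

(** Differentiating <g_z, nu> = 0 moves the second derivation onto the normal; [dz] gives the Hopf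
    function and [dzbar] the mean curvature. *)
Lemma derivation_mx_z_normal d : derivation z d ->
  B (entrywise d (mx_z z g) p) (nu p) = - B (mx_z z g p) (entrywise d nu p).
Proof.
move=> dd; have [snu _] := hnu; have [d0 _ _] := dd.
have := derivation_form p dd (smooth_mx_z hz sg) snu.
have -> : (fun q => B (mx_z z g q) (nu q)) = fun=> 0.
  by apply/funext => q; exact: normal_z.
by rewrite d0 => /esym/eqP; rewrite addr_eq0 => /eqP.
Qed.

Lemma hopfE : hopf z B g nu p = - B (mx_z z g p) (mx_z z nu p).
Proof. exact: (derivation_mx_z_normal (derivation_dz hz)). Qed.

Lemma mean_curvatureE : mean_curvature z B g nu p =
  - (2 * (conformal_factor z B g p)^-1 * B (mx_z z g p) (mx_zbar z nu p)).
Proof.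
rewrite /mean_curvature.
by rewrite [B _ _](derivation_mx_z_normal (derivation_dzbar hz)) mulrN.
Qed.

End Normal.
End SurfaceForms.

(** * The dual surface in Euclidean space *)

Section Dual.
Variables (R : realType) (S : topologicalType) (z : S -> R * R).
Hypothesis hz : complex_coordinate z.

Lemma dot_symmetric_bilinear : symmetric_bilinear (@dot R).
Proof.
split=> [X Y|c X Y Z]; rewrite /dot.
  by apply: eq_bigr => i _; rewrite mulrC.
rewrite mulr_sumr -big_split /=; apply: eq_bigr => i _.
by rewrite !mxE mulrDl mulrA.
Qed.

Lemma dot_conj (X Y : 'rV[R[i]]_3) :
  dot (map_mx Num.conj X) (map_mx Num.conj Y) = (dot X Y)^*.
Proof.
by rewrite /dot rmorph_sum /=; apply: eq_bigr => i _; rewrite !mxE rmorphM.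
Qed.

Lemma conj_real (x : R) : (x%:C : R[i])^* = x%:C.
Proof. exact: conjc_real. Qed.

(** A real-valued map is fixed by conjugation, which exchanges its z- and zbar-derivatives. *)
Lemma mx_zbar_cplx (f : S -> 'rV[R]_3) p : smooth_mx z (cplx f) ->
  mx_zbar z (cplx f) p = map_mx Num.conj (mx_z z (cplx f) p).
Proof.
move=> sf; apply/matrixP => i j; rewrite !mxE.
rewrite -(dzbar_conj hz); last exact: smooth_mxE.
congr (dzbar z _ p); apply/funext => q; rewrite !mxE.
exact/esym/conj_real.
Qed.

Lemma mx_z_cplx (f : S -> 'rV[R]_3) p : smooth_mx z (cplx f) ->
  mx_z z (cplx f) p = map_mx Num.conj (mx_zbar z (cplx f) p).
Proof.
move=> sf; apply/matrixP => i j; rewrite !mxE.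
rewrite -(dz_conj hz); last exact: smooth_mxE.
congr (dz z _ p); apply/funext => q; rewrite !mxE.
exact/esym/conj_real.
Qed.

Variables (f N : S -> 'rV[R]_3) (u : S -> R) (Q H : R).
Hypotheses (hH : H != 0) (hf : cmc_surface z f N H).
Hypothesis hnorm : normalized_isothermic z f N u Q H.

(** The Lawson correspondence for the dual needs its mean curvature and Hopf function with respect
    to [- N]. Both come from [dual_form], fed with the data of [f] and the prescribed metric of the
    dual. *)
Lemma dual_cmc :
  cmc_surface z (dual_surface f N H) (fun p => - N p) H /\
  forall p, hopf z (@dot R) (cplx (dual_surface f N H))
              (cplx (fun q => - N q)) p = Q%:C.
Proof.
have hB := dot_symmetric_bilinear.
case: hf => [[[sf _] _] hN hmc]; case: hnorm => _ fE dE hQ _.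
have [sN NN] := hN.
have Hn0 : H%:C != 0 by rewrite complex_eq0.
have dualE : cplx (dual_surface f N H) = fun q => cplx f q + H%:C^-1 *: cplx N q.
  apply/funext => q; apply/matrixP => i j.
  by rewrite !mxE rmorphD rmorphM fmorphV.
have oppE : cplx (fun q => - N q) = fun q => -1 *: cplx N q.
  by apply/funext => q; apply/matrixP => i j; rewrite !mxE rmorphN mulN1r.
have sHN : smooth_mx z (fun q => H%:C^-1 *: cplx N q) by exact: smooth_mxZ.
have sd : smooth_mx z (cplx (dual_surface f N H)).
  by rewrite dualE; exact: smooth_mxD.
have sn : smooth_mx z (cplx (fun q => - N q)).
  by rewrite oppE; exact: (smooth_mxZ hz).
have dd d p : derivation z d -> entrywise d (cplx (dual_surface f N H)) p =
    entrywise d (cplx f) p + H%:C^-1 *: entrywise d (cplx N) p.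
  by move=> hd; rewrite dualE (derivation_mxD _ hd) // (derivation_mxZ _ _ hd).
have dn d p : derivation z d -> entrywise d (cplx (fun q => - N q)) p =
    - entrywise d (cplx N) p.
  by move=> hd; rewrite oppE (derivation_mxZ _ _ hd) // scaleN1r.
have [dzP dzbP] := (derivation_dz hz, derivation_dzbar hz).
have hn : normal_field z (@dot R) (cplx (dual_surface f N H))
    (cplx (fun q => - N q)).
  split=> [|p]; first exact: sn.
  have [nn nx ny] := NN p.
  (* A coordinate derivative of the dual is that of [f] plus a multiple of that of [N], and both are
     orthogonal to [N]. *)
  have dN d : derivation z d -> dot (cplx N p) (entrywise d (cplx N) p) = 0.
    exact: (derivation_normal hz hB p hN).
  have dx := derivation_pd hz (or_introl erefl).
  have dy := derivation_pd hz (or_intror erefl).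
  rewrite [mx_x _ _ p](dd _ _ dx) [mx_y _ _ p](dd _ _ dy) oppE.
  split; first exact: (opp_unit_form hB nn).
  - exact: (opp_normal_form hB _ nx (dN _ dx)).
  - exact: (opp_normal_form hB _ ny (dN _ dy)).
have zz p : dot (mx_z z (cplx f) p) (mx_z z (cplx N) p) = - Q%:C.
  by rewrite -(hQ p) (hopfE hz hB p sf hN) opprK.
pose e p : R[i] := (expR (2 * u p))%:C.
have en0 p : e p != 0 by rewrite complex_eq0 gt_eqF ?expR_gt0.
pose e' p : R[i] := (expR (-2 * u p))%:C.
have e'n0 p : e' p != 0 by rewrite complex_eq0 gt_eqF ?expR_gt0.
(* The mean curvature formula solved for <f_z, N_zbar>. *)
have zzb p : dot (mx_z z (cplx f) p) (mx_zbar z (cplx N) p) =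
    - (H%:C * e p / 2).
  have [xx _ _] := fE p.
  have := hmc p; rewrite (mean_curvatureE hz hB p sf hN) /conformal_factor xx.
  rewrite -/(e p) => <-; move: (dot _ _) (e p) (en0 p) => a b b0.
  by field.
(* Complex conjugate of [zzb]: [f] and [N] are real, and so is the right side. *)
have zbz p : dot (mx_zbar z (cplx f) p) (mx_z z (cplx N) p) =
    - (H%:C * e p / 2).
  rewrite (mx_zbar_cplx p sf) (mx_z_cplx p sN) dot_conj zzb.
  by rewrite rmorphN !rmorphM fmorphV rmorph_nat /= !conj_real.
have dual p : dot (mx_z z (cplx (dual_surface f N H)) p)
      (- mx_z z (cplx N) p) = - Q%:C /\
    dot (mx_z z (cplx (dual_surface f N H)) p) (- mx_zbar z (cplx N) p) =
      - (H%:C * e' p / 2).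
  have [f0 _ f1] := metric_z hB p fE; have [d0 _ d1] := metric_z hB p dE.
  have Ez : mx_z z (cplx (dual_surface f N H)) p =
    mx_z z (cplx f) p + H%:C^-1 *: mx_z z (cplx N) p := dd _ p dzP.
  have Ezb : mx_zbar z (cplx (dual_surface f N H)) p =
    mx_zbar z (cplx f) p + H%:C^-1 *: mx_zbar z (cplx N) p := dd _ p dzbP.
  rewrite Ez in d0 d1 *; rewrite Ezb in d1.
  exact: (dual_form hB Hn0 f0 f1 (zz p) (zzb p) (zbz p) d0 d1).
have hopf_dual p : hopf z (@dot R) (cplx (dual_surface f N H))
    (cplx (fun q => - N q)) p = Q%:C.
  rewrite (hopfE hz hB p sd hn) [X in dot _ X](dn _ _ dzP).
  by rewrite (dual p).1 opprK.
split=> //; split=> [||p].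
- apply: (metric_immersion hB sd _ dE) => p; exact: expR_gt0.
- exact: hn.
- have cf : conformal_factor z (@dot R) (cplx (dual_surface f N H)) p = e' p.
    by have [dxx _ _] := dE p; exact: dxx.
  rewrite (mean_curvatureE hz hB p sd hn) cf.
  rewrite [X in dot _ X](dn _ _ dzbP) (dual p).2.
  by move: (H%:C) (e' p) (e'n0 p) => h x x0; field.
Qed.
End Dual.

(** * Minkowski space *)

Section Matrices.
Variable R : realType.
Implicit Types (G K X Y : 'M[R[i]]_2) (x y : R).

Lemma mx22P X : X = mx22 (X 0 0) (X 0 1) (X 1 0) (X 1 1).
Proof.
have ord2 (i : 'I_2) : i = 0 \/ i = 1.
  by case: i => [[|[|//]]] ?; [left|right]; exact: val_inj.
by apply/matrixP => i j; rewrite mxE; case: (ord2 i) (ord2 j) => -> [] ->.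
Qed.

Lemma mx22E (a b c d : R[i]) : ((mx22 a b c d 0 0 = a) * (mx22 a b c d 0 1 = b) *
  (mx22 a b c d 1 0 = c) * (mx22 a b c d 1 1 = d))%type.
Proof. by rewrite !mxE. Qed.

Lemma mx22_mul (a b c d a' b' c' d' : R[i]) :
  mx22 a b c d *m mx22 a' b' c' d' =
  mx22 (a * a' + b * c') (a * b' + b * d') (c * a' + d * c') (c * b' + d * d').
Proof.
rewrite [LHS]mx22P; rewrite !mxE !big_ord_recl !big_ord0 !addr0.
by rewrite !mxE.
Qed.

Lemma mx22_add (a b c d a' b' c' d' : R[i]) :
  mx22 a b c d + mx22 a' b' c' d' = mx22 (a + a') (b + b') (c + c') (d + d').
Proof. by rewrite [LHS]mx22P !mxE. Qed.

Lemma mx22_scale (k a b c d : R[i]) :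
  k *: mx22 a b c d = mx22 (k * a) (k * b) (k * c) (k * d).
Proof. by rewrite [LHS]mx22P !mxE. Qed.

Lemma mx22_adj (a b c d : R[i]) : (mx22 a b c d)^t* = mx22 a^* c^* b^* d^*.
Proof. by rewrite [LHS]mx22P !mxE. Qed.

Lemma mx22_1 : 1%:M = mx22 1 0 0 1 :> 'M[R[i]]_2.
Proof. by rewrite [LHS]mx22P !mxE. Qed.

Lemma det_mx22 (a b c d : R[i]) : \det (mx22 a b c d) = a * d - b * c.
Proof.
rewrite (expand_det_row _ 0) !big_ord_recl big_ord0 /cofactor !det_mx11 !mxE.
by rewrite /= addr0 mul1r expr1 mulN1r mulrN.
Qed.

(** This exhibits [mink] as the polarization of minus the determinant. *)
Lemma mink_mx22 (a b c d a' b' c' d' : R[i]) :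
  mink (mx22 a b c d) (mx22 a' b' c' d') =
  2^-1 * (b * c' + c * b' - a * d' - d * a').
Proof.
rewrite /mink.
have -> : (mx22 a' b' c' d')^T = mx22 a' c' b' d' by rewrite [LHS]mx22P !mxE.
rewrite !mx22_mul /mxtrace !big_ord_recl big_ord0 !mxE /=.
move: 'i (sqrCi R[i]) => i i2.
have -> : d = - (i ^+ 2) * d by rewrite i2 opprK mul1r.
have -> : a = - (i ^+ 2) * a by rewrite i2 opprK mul1r.
by field: i2.
Qed.

(** Polarized form of the multiplicativity of the determinant. *)
Lemma mink_mul G K X Y :
  mink (G *m X *m K) (G *m Y *m K) = \det G * \det K * mink X Y.
Proof.
rewrite [G]mx22P [K]mx22P [X]mx22P [Y]mx22P !mx22_mul !mink_mx22 !det_mx22.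
move: (G 0 0) (G 0 1) (G 1 0) (G 1 1) (K 0 0) (K 0 1) (K 1 0) (K 1 1).
move: (X 0 0) (X 0 1) (X 1 0) (X 1 1) (Y 0 0) (Y 0 1) (Y 1 0) (Y 1 1).
by move=> *; ring.
Qed.

Lemma adj_mul m n l (A : 'M[R[i]]_(m, n)) (C : 'M[R[i]]_(n, l)) :
  (A *m C)^t* = C^t* *m A^t*.
Proof. by rewrite trmx_mul map_mxM. Qed.

Lemma mink_conj G X Y : \det G = 1 ->
  mink (G *m X *m G^t*) (G *m Y *m G^t*) = mink X Y.
Proof.
by move=> dG; rewrite mink_mul det_map_mx det_tr dG rmorph1 !mul1r.
Qed.

Lemma mink_symmetric_bilinear : symmetric_bilinear (@mink R).
Proof.
split=> [X Y|k X Y Z].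
- rewrite [X]mx22P [Y]mx22P !mink_mx22.
  move: (X 0 0) (X 0 1) (X 1 0) (X 1 1) (Y 0 0) (Y 0 1) (Y 1 0) (Y 1 1).
  by move=> *; ring.
- rewrite [X]mx22P [Y]mx22P [Z]mx22P mx22_scale mx22_add !mink_mx22.
  move: (X 0 0) (X 0 1) (X 1 0) (X 1 1) (Y 0 0) (Y 0 1) (Y 1 0) (Y 1 1).
  move: (Z 0 0) (Z 0 1) (Z 1 0) (Z 1 1) => *.
  by ring.
Qed.

Lemma mink_offdiag x y x' y' :
  mink (mx22 0 x%:C y%:C 0) (mx22 0 x'%:C y'%:C 0) = ((x * y' + y * x') / 2)%:C.
Proof.
rewrite mink_mx22 !(rmorphM, rmorphD, fmorphV, rmorph_nat) /=.
by move: (x%:C) (y%:C) (x'%:C) (y'%:C) => *; field.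
Qed.

(** Hermitian symmetry makes the diagonal real and the upper right entry conjugate to the lower left
    one, leaving four real coordinates. *)
Lemma hermitian_mink_mx X : X^t* = X ->
  X = mink_mx ((complex.Re (X 0 0) + complex.Re (X 1 1)) / 2)
    (complex.Re (X 1 0)) (complex.Im (X 1 0))
    ((complex.Re (X 0 0) - complex.Re (X 1 1)) / 2).
Proof.
rewrite [X]mx22P mx22_adj => eX.
have e00 : (X 0 0)^* = X 0 0 by have /matrixP/(_ 0 0) := eX; rewrite !mxE.
have e01 : (X 1 0)^* = X 0 1 by have /matrixP/(_ 0 1) := eX; rewrite !mxE.
have e11 : (X 1 1)^* = X 1 1 by have /matrixP/(_ 1 1) := eX; rewrite !mxE.
rewrite /mink_mx !mx22E -e01.
have re (w : R[i]) : w^* = w -> w = (complex.Re w)%:C.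
  case: w => a b [/eqP]; rewrite eq_sym -subr_eq0 opprK -mulr2n mulrn_eq0.
  by move=> /eqP->.
congr mx22.
- rewrite {1}(re _ e00); congr (_%:C); move: (complex.Re _) (complex.Re _) => *.
  by field.
- by case: (X 1 0).
- by case: (X 1 0).
- rewrite {1}(re _ e11); congr (_%:C); move: (complex.Re _) (complex.Re _) => *.
  by field.
Qed.

(** The diagonal entries are sums of squared moduli, hence nonnegative, and determinant 1 makes
    their product at least 1. So half their sum, the coordinate x0, is positive. *)
Lemma H3_mul_adj G : \det G = 1 -> H3 (G *m G^t*).
Proof.
move=> dG; have herm : (G *m G^t*)^t* = G *m G^t*.
  by rewrite adj_mul trmxCK.
have dX : \det (G *m G^t*) = 1.
  by rewrite det_mulmx det_map_mx det_tr dG rmorph1 mulr1.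
have X00 i : 0 <= complex.Re ((G *m G^t*) i i).
  have : 0 <= (G *m G^t*) i i.
    by rewrite mxE sumr_ge0 // => j _; rewrite !mxE mul_conjC_ge0.
  by rewrite lecE => /andP[].
have eX := hermitian_mink_mx herm.
move: (X00 0) (X00 1) eX dX.
move: (complex.Re ((G *m G^t*) 0 0)) (complex.Re ((G *m G^t*) 1 1)) => x w.
move: (complex.Re ((G *m G^t*) 1 0)) (complex.Im ((G *m G^t*) 1 0)) => x1 x2.
move=> x_ge0 w_ge0 eX dX.
exists ((x + w) / 2), x1, x2, ((x - w) / 2); split=> //.
move: dX; rewrite eX /mink_mx det_mx22 => /(congr1 (@complex.Re _)) /=.
move=> /= dX; have : x * w = 1 + x1 ^+ 2 + x2 ^+ 2.
  by rewrite -dX; field.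
by move=> xw; nra.
Qed.

End Matrices.

(** * Surfaces with a moving frame *)

Section FrameSurface.
Variables (R : realType) (S : topologicalType) (z : S -> R * R).
Hypothesis hz : complex_coordinate z.

(** The adjoint exchanges the two derivatives, so the z-derivative of the adjoint of [G] involves
    [V] instead of [U]. *)
Lemma mx_z_congr (G : S -> 'M[R[i]]_2) (U V A : 'M[R[i]]_2) p : smooth_mx z G ->
  mx_z z G p = G p *m U -> mx_zbar z G p = G p *m V ->
  mx_z z (fun q => G q *m A *m (G q)^t*) p =
    G p *m (U *m A + A *m V^t*) *m (G p)^t* /\
  mx_zbar z (fun q => G q *m A *m (G q)^t*) p =
    G p *m (V *m A + A *m (U)^t*) *m (G p)^t*.
Proof.
move=> sG Gz Gzb.
have sA := smooth_mx_cst z A.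
have sGA := smooth_mxM hz sG sA; have sGt := smooth_mx_adj hz sG.
have [dzP dzbP] := (derivation_dz hz, derivation_dzbar hz).
split.
- rewrite [LHS](derivation_mxM hz p dzP sGA sGt).
  rewrite (derivation_mxM hz p dzP sG sA) (derivation_mx_cst _ _ dzP).
  rewrite mulmx0 addr0 [entrywise _ _ p]Gz.
  rewrite [entrywise _ (fun q => (G q)^t*) p](mx_z_adj hz p sG) Gzb adj_mul.
  by rewrite mulmxDr mulmxDl !mulmxA.
- rewrite [LHS](derivation_mxM hz p dzbP sGA sGt).
  rewrite (derivation_mxM hz p dzbP sG sA) (derivation_mx_cst _ _ dzbP).
  rewrite mulmx0 addr0 [entrywise _ _ p]Gzb.
  rewrite [entrywise _ (fun q => (G q)^t*) p](mx_zbar_adj hz p sG) Gz adj_mul.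
  by rewrite mulmxDr mulmxDl !mulmxA.
Qed.

(** The shape shared by F and FD. The off-diagonal entries are four separate real functions because
    gauging by D rescales [b] and [b'] inversely, and likewise [c] and [c']. *)
Definition frame_equation (G : S -> 'M[R[i]]_2) (al : S -> R[i])
    (b c b' c' : S -> R) : Prop :=
  [/\ smooth_mx z G, forall p, \det (G p) = 1,
      forall p, mx_z z G p =
        G p *m mx22 (- al p) (b p)%:C (- c p)%:C (al p) &
      forall p, mx_zbar z G p =
        G p *m mx22 (al p)^* (c' p)%:C (- b' p)%:C (- (al p)^*)].

Section Frame.
Variables (G : S -> 'M[R[i]]_2) (al : S -> R[i]) (b c b' c' : S -> R).
Hypothesis hG : frame_equation G al b c b' c'.

(** [m] and [k] are the off-diagonal entries of the z-derivative of the surface in the basis carried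
    by [G]. The Minkowski square of that derivative is m k, so m k = 0 expresses conformality. *)
Let m p := b p - b' p.
Let k p := c' p - c p.

Definition congr_offdiag (p : S) (x y : R) : 'M[R[i]]_2 :=
  G p *m mx22 0 x%:C y%:C 0 *m (G p)^t*.

Local Ltac gen_entries :=
  move: (al _) (al _)^* (b _)%:C (c _)%:C (b' _)%:C (c' _)%:C => ? ? ? ? ? ?.

Let sG : smooth_mx z G. Proof. by case: hG. Qed.
Let dG p : \det (G p) = 1. Proof. by case: hG. Qed.

Lemma hyp_surface_congr :
  hyp_surface G = fun p => G p *m 1%:M *m (G p)^t*.
Proof. by apply/funext => p; rewrite /hyp_surface mulmx1. Qed.

Lemma hyp_surface_z p :
  mx_z z (hyp_surface G) p = congr_offdiag p (m p) (k p) /\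
  mx_zbar z (hyp_surface G) p = congr_offdiag p (k p) (m p).
Proof.
case: hG => _ _ Gz Gzb; rewrite hyp_surface_congr.
have [-> ->] := mx_z_congr 1%:M sG (Gz p) (Gzb p).
rewrite !mulmx1 !mul1mx !mx22_adj !mx22_add !rmorphN /= !conj_real conjCK.
rewrite /congr_offdiag /m /k !rmorphB /=; gen_entries.
by split; congr (_ *m mx22 _ _ _ _ *m _); ring.
Qed.

Lemma hyp_normal_z p :
  mx_z z (hyp_normal G) p =
    congr_offdiag p (- (b p + b' p)) (- (c p + c' p)) /\
  mx_zbar z (hyp_normal G) p =
    congr_offdiag p (- (c p + c' p)) (- (b p + b' p)).
Proof.
case: hG => _ _ Gz Gzb.
have [-> ->] := mx_z_congr (mx22 1 0 0 (- 1)) sG (Gz p) (Gzb p).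
rewrite !mx22_adj !mx22_mul !mx22_add !rmorphN /= !conj_real conjCK.
rewrite /congr_offdiag !rmorphN !rmorphD /=; gen_entries.
by split; congr (_ *m mx22 _ _ _ _ *m _); ring.
Qed.

Lemma hyp_surface_x p : mx_x z (hyp_surface G) p =
  congr_offdiag p (m p + k p) (m p + k p).
Proof.
rewrite mx_xE (hyp_surface_z p).1 (hyp_surface_z p).2.
rewrite -mulmxDl -mulmxDr mx22_add !addr0 -!rmorphD /=.
by rewrite [k p + _]addrC.
Qed.

Lemma hyp_surface_y p : mx_y z (hyp_surface G) p =
  'i *: congr_offdiag p (m p - k p) (k p - m p).
Proof.
rewrite mx_yE (hyp_surface_z p).1 (hyp_surface_z p).2; congr (_ *: _).
rewrite -mulmxBl -mulmxBr -scaleN1r mx22_scale mx22_add.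
by rewrite !mulr0 !addr0 !mulN1r -!rmorphN -!rmorphD.
Qed.

Lemma mink_congr p x y x' y' :
  mink (congr_offdiag p x y) (congr_offdiag p x' y') =
  ((x * y' + y * x') / 2)%:C.
Proof. by rewrite mink_conj // mink_offdiag. Qed.

Lemma smooth_hyp_surface : smooth_mx z (hyp_surface G).
Proof. exact: (smooth_mxM hz sG (smooth_mx_adj hz sG)). Qed.

Lemma smooth_hyp_normal : smooth_mx z (hyp_normal G).
Proof.
apply: (smooth_mxM hz _ (smooth_mx_adj hz sG)).
exact: (smooth_mxM hz sG (smooth_mx_cst z _)).
Qed.

(** In the basis carried by [G], position and normal are diagonal and tangent vectors off-diagonal;
    [mink] vanishes between the two kinds. *)
Lemma hyp_normal_field : normal_field_H3 z (hyp_surface G) (hyp_normal G).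
Proof.
have off p x y : mink (hyp_normal G p) (congr_offdiag p x y) = 0.
  by rewrite mink_conj // mink_mx22 !mul0r !mulr0 !subr0 addr0 mulr0.
split=> [p|p|].
- do 4 eexists; apply: hermitian_mink_mx.
  rewrite /hyp_normal !adj_mul trmxCK mx22_adj mulmxA.
  have conjN1 : (-1 : R[i])^* = -1 by exact: rmorphN1.
  by rewrite conjN1 conjC0 conjC1.
- rewrite hyp_surface_congr mink_conj // mx22_1 mink_mx22.
  by ring.
- split=> [|p]; first exact: smooth_hyp_normal.
  rewrite hyp_surface_x hyp_surface_y off
    (formZr (@mink_symmetric_bilinear R)) off.
  rewrite mulr0 mink_conj // mink_mx22.
  by split=> //; field.
Qed.

Hypothesis mk0 : forall p, m p * k p = 0.
Hypothesis mk_neq0 : forall p, m p + k p != 0.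

Lemma hyp_surface_metric :
  has_metric z (@mink R) (hyp_surface G) (fun p => (m p + k p) ^+ 2).
Proof.
move=> p; rewrite hyp_surface_x hyp_surface_y.
rewrite !(formE (@mink_symmetric_bilinear R)).
rewrite !mink_congr; split.
- by congr (_%:C); move: (m p) (k p) => *; field.
- rewrite mulrA -expr2 sqrCi mulN1r -rmorphN /=; congr (_%:C).
  (* The y-derivative has square (m - k)^2, which agrees with (m + k)^2 because m k = 0. *)
  have -> : (m p + k p) ^+ 2 = (m p - k p) ^+ 2 + 4 * (m p * k p).
    by move: (m p) (k p) => *; ring.
  by rewrite mk0; move: (m p) (k p) => *; field.
- have -> : (m p + k p) * (k p - m p) + (m p + k p) * (m p - k p) = 0.
    by move: (m p) (k p) => *; ring.
  by rewrite mul0r mulr0.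
Qed.

Lemma hyp_surface_conformal : conformal_immersion z (@mink R) (hyp_surface G).
Proof.
apply: (metric_immersion (@mink_symmetric_bilinear R) smooth_hyp_surface _
  hyp_surface_metric) => p.
by rewrite exprn_even_gt0 //= mk_neq0.
Qed.

Lemma hyp_conformal_factor p :
  conformal_factor z (@mink R) (hyp_surface G) p = ((m p + k p) ^+ 2)%:C.
Proof. by have [xx _ _] := hyp_surface_metric p; exact: xx. Qed.

Lemma hyp_hopf p : hopf z (@mink R) (hyp_surface G) (hyp_normal G) p =
  ((m p * (c p + c' p) + k p * (b p + b' p)) / 2)%:C.
Proof.
have [_ _ hn] := hyp_normal_field.
rewrite (hopfE hz (@mink_symmetric_bilinear R) p smooth_hyp_surface hn).
rewrite (hyp_surface_z p).1 (hyp_normal_z p).1 mink_congr -rmorphN /=.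
by congr (_%:C); field.
Qed.

Lemma hyp_mean_curvature p :
  mean_curvature z (@mink R) (hyp_surface G) (hyp_normal G) p =
  ((m p * (b p + b' p) + k p * (c p + c' p)) / (m p + k p) ^+ 2)%:C.
Proof.
have [_ _ hn] := hyp_normal_field.
rewrite (mean_curvatureE hz (@mink_symmetric_bilinear R) p smooth_hyp_surface hn).
rewrite (hyp_surface_z p).1 (hyp_normal_z p).2 mink_congr hyp_conformal_factor.
rewrite -fmorphV -(rmorph_nat (real_complex R)) -!rmorphM -rmorphN /=.
congr (_%:C); move: (m p) (k p) (mk_neq0 p) => x y xy0.
by field.
Qed.

(** The hypothesis is the constancy of the mean curvature formula with its denominator cleared. *)
Lemma hyp_isothermic_cmc h :
  (forall p, m p * (b p + b' p) + k p * (c p + c' p) = h * (m p + k p) ^+ 2) ->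
  isothermic_cmc_H3 z (hyp_surface G) (hyp_normal G).
Proof.
move=> hh; split.
- by move=> p; exact: H3_mul_adj.
- split=> [|p]; first exact: hyp_surface_conformal.
  by rewrite hyp_hopf; apply/complex_realP; eexists.
- exact: hyp_normal_field.
- exists h => p; rewrite hyp_mean_curvature hh mulfK //.
  by rewrite expf_neq0.
Qed.

End Frame.

(** Serves the surface built from FD: its mean curvature for [hyp_normal] is negative, whereas the
    Lawson correspondence prescribes a positive one. *)
Lemma normal_field_H3_opp (g nu : S -> 'M[R[i]]_2) :
  normal_field_H3 z g nu -> normal_field_H3 z g (fun p => - nu p).
Proof.
have hB := @mink_symmetric_bilinear R.
case=> re gn [sn nn]; split=> [p|p|].
- have [x0 [x1 [x2 [x3 ->]]]] := re p.
  exists (- x0), (- x1), (- x2), (- x3).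
  rewrite -scaleN1r mx22_scale /mink_mx; congr mx22.
  + by rewrite mulN1r -rmorphN opprD.
  + by rewrite mulN1r.
  + by rewrite mulN1r.
  + by rewrite mulN1r -rmorphN opprB opprK addrC.
- by rewrite (formNl hB) gn oppr0.
- split=> [|p].
    have -> : (fun p => - nu p) = fun p => -1 *: nu p.
      by apply/funext => p; rewrite scaleN1r.
    exact: (smooth_mxZ hz).
  have [n1 nx ny] := nn p.
  move: (mx_x z g p) (mx_y z g p) (nu p) n1 nx ny => vx vy n0 n1 nx ny.
  by rewrite !(formNl hB) (formNr hB) nx ny n1 opprK oppr0.
Qed.

Lemma hopf_opp (g nu : S -> 'M[R[i]]_2) p :
  hopf z (@mink R) g (fun q => - nu q) p = - hopf z (@mink R) g nu p.
Proof. exact: (formNr (@mink_symmetric_bilinear R)). Qed.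

Lemma mean_curvature_opp (g nu : S -> 'M[R[i]]_2) p :
  mean_curvature z (@mink R) g (fun q => - nu q) p =
  - mean_curvature z (@mink R) g nu p.
Proof.
rewrite /mean_curvature -mulrN; congr (_ * _).
exact: (formNr (@mink_symmetric_bilinear R)).
Qed.

End FrameSurface.

(** * The extended frame *)

Section Frames.
Variables (R : realType) (S : topologicalType) (z : S -> R * R).
Hypothesis hz : complex_coordinate z.

(** The gauge is constant, so it conjugates both coefficient matrices: diagonals stay, upper right
    entries are multiplied by [l] and lower left ones divided by it. *)
Lemma frame_equation_gauge (G : S -> 'M[R[i]]_2) al b c b' c' (s l : R) :
  s != 0 -> s * s = l -> frame_equation z G al b c b' c' ->
  frame_equation z (fun p => G p *m mx22 s^-1%:C 0 0 s%:C) al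
    (fun p => b p * l) (fun p => c p / l)
    (fun p => b' p / l) (fun p => c' p * l).
Proof.
move=> s0 sl [sG dG Gz Gzb]; set D := mx22 _ _ _ _.
have sD := smooth_mx_cst z D.
have [dzP dzbP] := (derivation_dz hz, derivation_dzbar hz).
have sC0 : s%:C != 0 by rewrite complex_eq0.
have lE : l%:C = s%:C * s%:C by rewrite -sl rmorphM.
split=> [|p|p|p].
- exact: (smooth_mxM hz).
- by rewrite det_mulmx dG mul1r det_mx22 mulr0 subr0 -rmorphM /= mulVf.
- rewrite [LHS](derivation_mxM hz p dzP sG sD) (derivation_mx_cst _ _ dzP).
  rewrite mulmx0 addr0 [entrywise _ _ p]Gz -!mulmxA; congr (_ *m _).
  (* It remains to compare, entry by entry, the old matrix times [D] with [D] times the new one. *)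
  rewrite !mx22_mul !rmorphN !rmorphM !fmorphV /= lE.
  move: (al p) (b p)%:C (c p)%:C (s%:C) sC0 => x y w t t0.
  by congr mx22; field.
- rewrite [LHS](derivation_mxM hz p dzbP sG sD) (derivation_mx_cst _ _ dzbP).
  rewrite mulmx0 addr0 [entrywise _ _ p]Gzb -!mulmxA; congr (_ *m _).
  rewrite !mx22_mul !rmorphN !rmorphM !fmorphV /= lE.
  move: (al p)^* (b' p)%:C (c' p)%:C (s%:C) sC0 => x y w t t0.
  by congr mx22; field.
Qed.

Lemma real_annulus (r l : R) : 0 < r < 1 -> r < l < 1 -> annulus r l%:C.
Proof.
move=> /andP[r0 r1] /andP[rl l1]; have l0 : 0 < l by exact: lt_trans rl.
rewrite /annulus /= normc_def /= expr0n /= addr0 sqrtr_sqr (gtr0_norm l0).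
rewrite !ltcR; split=> //; apply: lt_trans l1 _.
by rewrite -invr1 ltf_pV2 ?posrE.
Qed.

(** As [u] is real, u_zbar is the conjugate of u_z, so the diagonals fit with al = u_z / 2. Here [c]
    and [c'] coincide, which makes [k] vanish for F. *)
Lemma extended_frame_equation (u : S -> R) (Q H r l : R) F :
  smooth z u -> annulus r l%:C -> extended_frame z r u Q H F ->
  frame_equation z (fun p => F p l%:C)
    (fun p => 2^-1 * dz z (fun q => (u q)%:C) p)
    (fun p => expR (- u p) * l^-1 * Q) (fun p => H * expR (u p) / 2)
    (fun p => expR (- u p) * l * Q) (fun p => H * expR (u p) / 2).
Proof.
move=> su hl [smF _ _ eqF]; have [dF sF] := smF _ hl.
have sC : csmooth z (fun q => (u q)%:C) by split=> //; exact: smooth_cst.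
have conj_dz p : (2^-1 * dz z (fun q => (u q)%:C) p)^* =
    2^-1 * dzbar z (fun q => (u q)%:C) p.
  rewrite rmorphM fmorphV rmorph_nat /= -(dzbar_conj hz p sC).
  by congr (_ * dzbar z _ p); apply/funext => q; exact: conj_real.
split=> [||p|p]; [exact: sF|exact: dF| |].
- rewrite (eqF _ p hl).1 /frame_U mx22_scale; congr (_ *m _).
  rewrite rmorphN !rmorphM !fmorphV !rmorph_nat /=.
  move: (dz z _ p) (expR _)%:C (expR _)%:C (l%:C)^-1 (Q%:C) (H%:C) => *.
  by congr mx22; field.
- rewrite (eqF _ p hl).2 /frame_V mx22_scale; congr (_ *m _).
  rewrite conj_dz rmorphN !rmorphM !fmorphV !rmorph_nat /=.
  move: (dzbar z _ p) (expR _)%:C (expR _)%:C (l%:C) (Q%:C) (H%:C) => *.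
  by congr mx22; field.
Qed.

End Frames.

(** The mean curvature prescribed by Lawson for s = Q (l^-1 - l) and H = 2Q. It rests on (l^-1 +
    l)^2 = (l^-1 - l)^2 + 4; the range of [l] fixes the sign of the root. *)
Lemma sqrt_curvature (R : realType) (l Q : R) : Q != 0 -> 0 < l < 1 ->
  Num.sqrt (((Q * (l^-1 - l))^-1 * (2 * Q)) ^+ 2 + 1) =
  (l^-1 + l) / (l^-1 - l).
Proof.
move=> Q0 /andP[l0 l1].
have A0 : 0 < l^-1 - l by rewrite subr_gt0 (lt_trans l1) // invf_gt1.
have P0 : 0 < l^-1 + l by rewrite addr_gt0 ?invr_gt0.
have -> : ((Q * (l^-1 - l))^-1 * (2 * Q)) ^+ 2 + 1 =
    ((l^-1 + l) / (l^-1 - l)) ^+ 2.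
  have PA : (l^-1 + l) ^+ 2 = (l^-1 - l) ^+ 2 + 4.
    by have l_neq0 := lt0r_neq0 l0; field.
  rewrite [RHS]exprMn exprVn PA; move: (l^-1 - l) (lt0r_neq0 A0) => A An0.
  by field; apply/andP.
by rewrite sqrtr_sqr ger0_norm // divr_ge0 // ltW.
Qed.

(** * The two surfaces in hyperbolic space *)

Theorem theorem1 (R : realType) (S : topologicalType) (z : S -> R * R)
    (f N : S -> 'rV[R]_3) (u : S -> R) (Q H : R)
    (r : R) (F : S -> R[i] -> 'M[R[i]]_2) (lambda : R)
    (hS : hausdorff_space S) (hsc : simply_connected R S)
    (hz : complex_coordinate z)
    (hH : H != 0) (hf : cmc_surface z f N H)
    (hsphere : ~ in_round_sphere f)
    (humb : forall p, hopf z (@dot R) (cplx f) (cplx N) p != 0)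
    (hu : smooth z u) (hnorm : normalized_isothermic z f N u Q H)
    (hr : 0 < r < 1) (hF : extended_frame z r u Q H F)
    (hlambda : r < lambda < 1) :
  let D := mx22 (Num.sqrt lambda)^-1%:C 0 0 (Num.sqrt lambda)%:C in
  let G1 := fun p => F p lambda%:C in
  let G2 := fun p => F p lambda%:C *m D in
  let g1 := hyp_surface G1 in
  let g2 := hyp_surface G2 in
  let n1 := hyp_normal G1 in
  let n2 := hyp_normal G2 in
  [/\ isothermic_cmc_H3 z g1 n1,
      isothermic_cmc_H3 z g2 n2,
      exists s : R, s != 0 /\
        lawson_correspondent z s (dual_surface f N H) (fun p => - N p) g1,
      exists s : R, s != 0 /\ lawson_correspondent z s f N g2 &
      equidistant g1 n1 g2 /\
      forall p, mean_curvature z (@mink R) g2 n2 p =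
                - mean_curvature z (@mink R) g1 n1 p].
Proof.
move=> D G1 G2 g1 g2 n1 n2.
have [_ fE dE hQ H2Q] := hnorm.
have Q0 : Q != 0 by move: hH; rewrite H2Q mulf_eq0 negb_or => /andP[].
have /andP[rl l1] := hlambda; have /andP[r0 _] := hr.
have l0 : 0 < lambda := lt_trans r0 rl.
have l_neq0 := lt0r_neq0 l0.
(* [Q * A] will be the homothety factor s for both surfaces, and [P / A] their mean curvature up to
   sign. *)
pose A := lambda^-1 - lambda; pose P := lambda^-1 + lambda.
have A_gt0 : 0 < A by rewrite subr_gt0 (lt_trans l1) // invf_gt1.
have A0 := lt0r_neq0 A_gt0.
have hann := real_annulus hr hlambda.
have fe1 := extended_frame_equation hz hu hann hF; rewrite -/G1 in fe1.
have sq : Num.sqrt lambda * Num.sqrt lambda = lambda.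
  by rewrite -expr2 sqr_sqrtr // ltW.
have sq0 : Num.sqrt lambda != 0 by rewrite sqrtr_eq0 -ltNge.
have fe2 := frame_equation_gauge hz sq0 sq fe1; rewrite -/D -/G2 in fe2.
pose e p := expR (u p).
have e0 p : e p != 0 by rewrite gt_eqF ?expR_gt0.
have eN p : expR (- u p) = (e p)^-1 by rewrite expRN.
have e2 p : expR (2 * u p) = e p ^+ 2 by rewrite mulr_natl mulr2n expRD.
have eN2 p : expR (- 2 * u p) = (e p)^-1 ^+ 2.
  by rewrite mulNr mulr_natl mulr2n opprD expRD eN.
have s0 : Q * A != 0 by rewrite mulf_neq0.
(* Entries for both frames: F has m = QA / e and k = 0, while FD has m = 0 and, by H = 2Q, k = - e
   QA. Thus (m + k)^2 is (QA)^2 times the conformal factor of the dual, respectively of [f]. *)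
have m1 p : expR (- u p) * lambda^-1 * Q - expR (- u p) * lambda * Q =
    (e p)^-1 * (Q * A) by rewrite eN /A; ring.
have b1 p : expR (- u p) * lambda^-1 * Q + expR (- u p) * lambda * Q =
    (e p)^-1 * (Q * P) by rewrite eN /P; ring.
have k1 p : H * expR (u p) / 2 - H * expR (u p) / 2 = 0 by rewrite subrr.
have c1 p : H * expR (u p) / 2 + H * expR (u p) / 2 = H * e p.
  by rewrite -/(e p); field.
have m2 p : expR (- u p) * lambda^-1 * Q * lambda -
    expR (- u p) * lambda * Q / lambda = 0 by rewrite eN; field; apply/andP.
have b2 p : expR (- u p) * lambda^-1 * Q * lambda +
    expR (- u p) * lambda * Q / lambda = 2 * (e p)^-1 * Q.
  by rewrite eN; field; apply/andP.
have k2 p : H * expR (u p) / 2 * lambda - H * expR (u p) / 2 / lambda =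
    - (e p * (Q * A)) by rewrite -/(e p) H2Q /A; field.
have c2 p : H * expR (u p) / 2 / lambda + H * expR (u p) / 2 * lambda =
    e p * (Q * P) by rewrite -/(e p) H2Q /P; field.
have mk1 p : (expR (- u p) * lambda^-1 * Q - expR (- u p) * lambda * Q) *
    (H * expR (u p) / 2 - H * expR (u p) / 2) = 0 by rewrite k1 mulr0.
have mk1n p : expR (- u p) * lambda^-1 * Q - expR (- u p) * lambda * Q +
    (H * expR (u p) / 2 - H * expR (u p) / 2) != 0.
  by rewrite k1 addr0 m1 mulf_neq0 ?invr_eq0.
have mk2 p : (expR (- u p) * lambda^-1 * Q * lambda -
    expR (- u p) * lambda * Q / lambda) *
    (H * expR (u p) / 2 * lambda - H * expR (u p) / 2 / lambda) = 0.
  by rewrite m2 mul0r.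
have mk2n p : expR (- u p) * lambda^-1 * Q * lambda -
    expR (- u p) * lambda * Q / lambda +
    (H * expR (u p) / 2 * lambda - H * expR (u p) / 2 / lambda) != 0.
  by rewrite m2 add0r k2 oppr_eq0 mulf_neq0.
(* The mean curvature reduces to (b + b') / m when k = 0 and to (c + c') / k when m = 0; the minus
   sign in [k2] makes the two values opposite. *)
have mc1 p : mean_curvature z (@mink R) g1 n1 p = (P / A)%:C.
  rewrite [LHS](hyp_mean_curvature hz fe1 mk1 mk1n) /= m1 b1 k1.
  congr (_%:C); move: (e p) (e0 p) => x x0.
  by rewrite mul0r !addr0; field; apply/and3P.
have mc2 p : mean_curvature z (@mink R) g2 n2 p = (- (P / A))%:C.
  rewrite [LHS](hyp_mean_curvature hz fe2 mk2 mk2n) /= m2 k2 c2.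
  congr (_%:C); move: (e p) (e0 p) => x x0.
  by rewrite mul0r !add0r; field; apply/and3P.
have lawson_curvature : Num.sqrt (((Q * A)^-1 * H) ^+ 2 + 1) = P / A.
  by rewrite H2Q sqrt_curvature // l0.
have [dcmc dhopf] := dual_cmc hz hH hf hnorm.
split.
- apply: (hyp_isothermic_cmc hz fe1 mk1 mk1n (h := P / A)) => p.
  rewrite m1 b1 k1; move: (e p) (e0 p) => x x0.
  by rewrite mul0r !addr0; field; apply/andP.
- apply: (hyp_isothermic_cmc hz fe2 mk2 mk2n (h := - (P / A))) => p.
  by rewrite m2 k2 c2; move: (e p) => x; rewrite mul0r !add0r; field.
- exists (Q * A); split=> //; split.
  + by move=> p; apply: H3_mul_adj; case: fe1.
  + exact: (hyp_surface_conformal hz fe1 mk1 mk1n).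
  + exists H, n1; split=> // [|p]; first exact: (hyp_normal_field hz fe1).
    have dxx : conformal_factor z (@dot R) (cplx (dual_surface f N H)) p =
        (expR (- 2 * u p))%:C by have [xx _ _] := dE p; exact: xx.
    split.
    * rewrite [LHS](hyp_conformal_factor hz fe1 mk1) /=.
      rewrite dxx -rmorphXn -rmorphM /=; congr (_%:C).
      by rewrite m1 k1 eN2 addr0 exprMn mulrC.
    * rewrite [LHS](hyp_hopf hz fe1) /= dhopf -rmorphM /=; congr (_%:C).
      rewrite m1 k1 c1 H2Q mul0r addr0; move: (e p) (e0 p) => x x0.
      by field.
    * by rewrite mc1 lawson_curvature.
- exists (Q * A); split=> //; split.
  + by move=> p; apply: H3_mul_adj; case: fe2.
  + exact: (hyp_surface_conformal hz fe2 mk2 mk2n).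
  (* Reversing the normal turns the mean curvature - P / A into P / A and the Hopf function - Q (QA)
     into s Q. *)
  + exists H, (fun p => - n2 p); split=> // [|p].
      exact: (normal_field_H3_opp hz (hyp_normal_field hz fe2)).
    have fxx : conformal_factor z (@dot R) (cplx f) p = (expR (2 * u p))%:C.
      by have [xx _ _] := fE p; exact: xx.
    split.
    * rewrite [LHS](hyp_conformal_factor hz fe2 mk2) /=.
      rewrite fxx -rmorphXn -rmorphM /=; congr (_%:C).
      by rewrite m2 k2 e2 add0r sqrrN exprMn mulrC.
    * rewrite hopf_opp [hopf _ _ _ _ _](hyp_hopf hz fe2) /= hQ -rmorphN -rmorphM.
      congr (_%:C); rewrite m2 k2 b2 mul0r add0r.
      by move: (e p) (e0 p) => x x0; field.
    * rewrite mean_curvature_opp mc2 -rmorphN lawson_curvature.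
      by rewrite /= opprK.
- split; last by move=> p; rewrite mc1 mc2 rmorphN.
  (* For this t, exp t = 1 / lambda, so D times its adjoint, diag(1 / lambda, lambda), is cosh t
     times the identity plus sinh t times diag(1, -1). Congruence by [G1] gives the parallel
     surface. *)
  exists (- ln lambda) => p; rewrite opprK expRN !lnK ?posrE // -/A -/P.
  rewrite [g1 p](congr1 (@^~ p) (hyp_surface_congr G1)) mx22_1.
  have -> : g2 p = G1 p *m (D *m D^t*) *m (G1 p)^t*.
    by rewrite /g2 /hyp_surface /G2 adj_mul !mulmxA.
  have -> : D *m D^t* = ((lambda^-1 + lambda) / 2)%:C *: mx22 1 0 0 1 +
      ((lambda^-1 - lambda) / 2)%:C *: mx22 1 0 0 (-1).
    rewrite mx22_adj mx22_mul !mx22_scale mx22_add conjC0 !conj_real.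
    rewrite !mulr0 !mul0r !addr0 !mulr1 !add0r mulrN1 -!rmorphM -rmorphN -!rmorphD.
    by rewrite /= -invfM sq; congr mx22; congr (_%:C); field.
  by rewrite mulmxDr mulmxDl -!scalemxAr -!scalemxAl.
Qed.
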